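(* Let $\mu$ be a strong limit singular cardinal and $\lambda$ a cardinal with $\aleph_0<{\rm cf}(\mu)<\mu<{\rm cf}(\lambda)<\lambda\le 2^\mu$. Then there is a Boolean algebra ${\mathbb B}$ such that $|{\mathbb B}|=\lambda=s({\mathbb B})$, $s^+({\mathbb B})=\lambda$ (so the spread is not attained), and moreover ${\rm hd}^+({\mathbb B})={\rm hL}^+({\mathbb B})=\lambda$.
   Context: For a Boolean algebra ${\mathbb B}$: $s({\mathbb B})$ is the supremum of the cardinals $\theta$ for which there is a sequence $\langle a_\alpha:\alpha<\theta\rangle$ of nonzero elements such that no $a_\alpha$ lies in the ideal generated by $\{a_\beta:\beta\ne\alpha\}$; $s^+({\mathbb B})$ is the least cardinal $\theta$ for which no such sequence of length $\theta$ exists. ${\rm hd}^+({\mathbb B})$ (resp. ${\rm hL}^+({\mathbb B})$) is the least $\theta$ for which there is no sequence $\langle a_\alpha:\alpha<\theta\rangle$ of nonzero elements such that each $a_\alpha$ is not in the ideal generated by $\{a_\beta:\beta<\alpha\}$ (resp. by $\{a_\beta:\beta>\alpha\}$). *)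

(* Defs.v *)
From mathcomp Require Import all_boot all_order.
From mathcomp Require Import all_classical.
From mathcomp Require Export wochoice.

Set Implicit Arguments.
Unset Strict Implicit.
Unset Printing Implicit Defensive.

Local Open Scope classical_set_scope.
Local Open Scope card_scope.

(* A cardinal is an initial ordinal: a well-ordered type none of whose proper
   initial segments is equipotent to the whole. [well_order] (every nonempty
   subset has a unique minimum) already forces [cle] to be a total order. *)
Record cardinal := Cardinal {
  csort :> Type;
  cle : rel csort;
  cle_wo : well_order cle;
  cle_initial : forall x : csort,
    ~ ([set: csort] #<= [set y : csort | ~~ cle x y])
}.

Definition clt (kappa : cardinal) (x y : kappa) : Prop := ~~ cle y x.

(* Comparison of the sizes of types, in particular of cardinals. *)
Definition type_card_le (T U : Type) : Prop := [set: T] #<= [set: U].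
Definition type_card_eq (T U : Type) : Prop := [set: T] #= [set: U].
Definition type_card_lt (T U : Type) : Prop := type_card_le T U /\ ~ type_card_le U T.

Definition is_least_cardinal (P : cardinal -> Prop) (kappa : cardinal) : Prop :=
  P kappa /\ forall theta : cardinal, P theta -> type_card_le kappa theta.

(* As cardinals are considered up to equipotence, cf, s, s^+, hd^+ and hL^+ are
   relations "kappa is the cardinal ...", each pinned down by [is_least_cardinal]. *)

Definition cofinal (kappa : cardinal) (A : set kappa) : Prop :=
  forall x : kappa, exists2 y, A y & cle x y.

Definition is_cf (kappa theta : cardinal) : Prop :=
  is_least_cardinal
    (fun eta : cardinal =>
       exists2 A : set kappa, cofinal A & A #= [set: eta]) theta.

Definition infinite_cardinal (kappa : cardinal) : Prop := type_card_le nat kappa.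

Definition singular (kappa : cardinal) : Prop :=
  infinite_cardinal kappa /\
  exists2 theta : cardinal, is_cf kappa theta & type_card_lt theta kappa.

Definition strong_limit (kappa : cardinal) : Prop :=
  infinite_cardinal kappa /\
  forall theta : cardinal, type_card_lt theta kappa -> type_card_lt (set theta) kappa.

Section BooleanAlgebra.
Context {d : Order.disp_t} {B : ctbDistrLatticeType d}.

Definition is_ideal (I : set B) : Prop :=
  [/\ I Order.bottom,
      forall x y : B, (x <= y)%O -> I y -> I x
    & forall x y : B, I x -> I y -> I (Order.join x y)].

Definition ideal_gen (X : set B) : set B := smallest is_ideal X.

(* No [a alpha] is in the ideal generated by the [a beta] with [R alpha beta]. *)
Definition ideal_free (T : Type) (R : T -> T -> Prop) (a : T -> B) : Prop :=
  forall alpha : T,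
    a alpha <> Order.bottom /\
    ~ ideal_gen (a @` [set beta | R alpha beta]) (a alpha).

End BooleanAlgebra.

Section Invariants.
Context {d : Order.disp_t} (B : ctbDistrLatticeType d).

Definition has_s_seq (theta : cardinal) : Prop :=
  exists a : theta -> B, ideal_free (fun alpha beta => beta <> alpha) a.

Definition has_hd_seq (theta : cardinal) : Prop :=
  exists a : theta -> B, ideal_free (fun alpha beta => clt beta alpha) a.

Definition has_hL_seq (theta : cardinal) : Prop :=
  exists a : theta -> B, ideal_free (fun alpha beta => clt alpha beta) a.

(* The supremum, i.e. the least upper bound among cardinals. *)
Definition is_s (kappa : cardinal) : Prop :=
  is_least_cardinal
    (fun eta => forall theta, has_s_seq theta -> type_card_le theta eta) kappa.

Definition is_s_plus (kappa : cardinal) : Prop :=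
  is_least_cardinal (fun theta => ~ has_s_seq theta) kappa.

Definition is_hd_plus (kappa : cardinal) : Prop :=
  is_least_cardinal (fun theta => ~ has_hd_seq theta) kappa.

Definition is_hL_plus (kappa : cardinal) : Prop :=
  is_least_cardinal (fun theta => ~ has_hL_seq theta) kappa.

End Invariants.

(* Main.v *)
(* For T = cf(lam), pcf-style scales below mu give T branches through a tree with cf(mu)
   levels, each level having fewer than mu nodes, such that the nodes of T branches are never
   determined, level by level, by subsets of mu restricted to slowly growing bounded parts Ps d.
   To this end a strongly unbounded T-sequence in a product of cf(mu) regular cardinals below mu
   is replaced by one in a product of cofinalities of subproducts, localized by pressing down
   at a discrete set of levels.

   Each index a < lam is assigned a branch, with fewer than lam indices per branch, and a subset
   D a of mu. The algebra of sets is generated by sets depending only on a node and a bounded part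
   of D, and by gen a, which consists of a and the indices whose branch leaves that of a to the
   right at a level d where D still agrees with D a on Ps d. The gen a with a in one class of
   indices with the same branch are independent modulo ideals, which gives free sequences of all
   lengths below lam. Conversely, cut each member of a free sequence of length lam into finitely
   many pieces and keep one piece outside its ideal; many members share the same coded part of
   the piece, and the splitting property of the tree gives two of them whose branches split at
   some level while the traces agree. Then the part of one piece that follows its branch up to
   that level is contained in the other member, which contradicts freeness. *)

From HB Require Import structures.
Require Import Defs.
From mathcomp Require Import all_boot all_order.
From mathcomp Require Import all_classical.

Set Implicit Arguments.
Unset Strict Implicit.
Unset Printing Implicit Defensive.

Local Open Scope classical_set_scope.
Local Open Scope card_scope.

(** * Cardinalities as injections *)

(** The product of the [c i] would not serve directly as a tree. A factor [c i] may lie between the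
    size of a level and that of its power set, and then the trace on that level can decide the
    coordinate [i]; deleting such coordinates may lower the cofinality. If the factors over [e] are
    unbounded below a limit level [d], the cofinality of the subproduct over [e] exceeds the power
    sets of all levels before [d], while [e] is visible at [d]. A discrete set of such [d] leaves
    room before each of them for the traces to stop. That one discrete set suffices is proved by
    contradiction: otherwise fewer than [th] codes would determine points that are cofinal in the
    original product. The coding uses points closed under scales; a second layer, families of
    subproducts, codes their values on one family. Uncountability of cf(mu) excludes infinite
    descent of functions modulo tails and provides levels closed under a given function. [gen a] is
    asymmetric because the chosen piece may lie inside a generator or outside finitely many; for
    either sign, one of two splitting branches is on the suitable side. *)

Definition inj_le (T U : Type) : Prop := exists f : T -> U, injective f.
Notation "T <~ U" := (inj_le T U) (at level 70, no associativity).

Definition sub (T : Type) (A : set T) : Type := {x : T | A x}.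

Lemma sub_eq T (A : set T) (x y : sub A) : sval x = sval y -> x = y.
Proof. by case: x => x Ax; case: y => y Ay /= e; apply: eq_exist. Qed.

Lemma inj_le_refl T : T <~ T. Proof. by exists id. Qed.

Lemma inj_le_trans U T V : T <~ U -> U <~ V -> T <~ V.
Proof. by move=> [f fi] [g gi]; exists (g \o f); apply: inj_comp. Qed.

Lemma card_le_sub T U (A : set T) (B : set U) : A #<= B <-> sub A <~ sub B.
Proof.
split.
- move=> /card_leP[f].
  exists (fun x : sub A =>
    exist _ (sval (f (exist _ (sval x) (mem_set (svalP x)))))
            (set_mem (svalP (f (exist _ (sval x) (mem_set (svalP x))))))).
  move=> x y [] /val_inj e; apply: sub_eq.
  have := (@inj _ _ _ f) _ _ _ _ e; rewrite !inE => /(_ I I).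
  by case.
- move=> [f fi]; apply/card_leP.
  pose g (x : A) : B :=
    exist _ (sval (f (exist _ (sval x) (set_mem (svalP x)))))
            (mem_set (svalP (f (exist _ (sval x) (set_mem (svalP x)))))).
  have gi : injective g.
    move=> x y [] e; apply: val_inj => /=.
    by have [] := fi _ _ (sub_eq e).
  have gi' : {in [set: A] &, injective g} by move=> x y _ _; exact: gi.
  have [j ej] := Pinj gi'.
  have [i _] := @injPfun _ _ [set: A] [set: B] j (fun _ _ => I).
  exact: squash i.
Qed.

Lemma inj_leP T U : type_card_le T U <-> T <~ U.
Proof.
rewrite /type_card_le card_le_sub.
have h V : sub [set: V] <~ V.
  by exists sval => x y; apply: sub_eq.
have h' V : V <~ sub [set: V].
  by exists (fun x => exist _ x I) => x y [].
split=> H; [apply: inj_le_trans (h U); apply: inj_le_trans H; exact: h'|].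
by apply: inj_le_trans (h' U); apply: inj_le_trans H; exact: h.
Qed.

Lemma sub_inj T U (A : set T) (f : T -> U) :
  (forall x y, A x -> A y -> f x = f y -> x = y) -> sub A <~ U.
Proof.
move=> fi; exists (fun x => f (sval x)) => x y e; apply: sub_eq.
exact: fi (svalP x) (svalP y) e.
Qed.

Lemma sub_le T (A : set T) : sub A <~ T.
Proof. exact: (@sub_inj _ _ _ id). Qed.

Lemma inj_sub T U (B : set U) (f : T -> U) :
  injective f -> (forall x, B (f x)) -> T <~ sub B.
Proof.
move=> fi fB; exists (fun x => exist _ (f x) (fB x)) => x y [] e; exact: fi.
Qed.

Lemma sub_mono T (A B : set T) : A `<=` B -> sub A <~ sub B.
Proof.
move=> AB; apply: (@inj_sub _ _ _ sval) => [x y|x]; first exact: sub_eq.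
exact: AB (svalP x).
Qed.

Lemma surj_inj T U (f : T -> U) : (forall u, exists t, f t = u) -> U <~ T.
Proof.
move=> /choice[g gK]; exists g => x y e.
by rewrite -(gK x) -(gK y) e.
Qed.

Lemma rel_inj T U (R : T -> U -> Prop) : (forall t, exists u, R t u) ->
  (forall t t' u, R t u -> R t' u -> t = t') -> T <~ U.
Proof.
move=> /choice[f fR] Ri; exists f => x y e.
by apply: (Ri _ _ (f x)); [|rewrite e].
Qed.

Lemma prod_mono T T' U U' : T <~ T' -> U <~ U' -> (T * U)%type <~ (T' * U')%type.
Proof.
by move=> [f fi] [g gi]; exists (fun p => (f p.1, g p.2)) => -[a b] [c d] [] /fi -> /gi ->.
Qed.

Lemma set_mono T U : T <~ U -> set T <~ set U.
Proof.
move=> [f fi]; exists (fun A => f @` A) => A B e.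
rewrite predeqE => x; split=> Ax.
  have : (f @` A) (f x) by exists x.
  by rewrite e => -[y By /fi <-].
have : (f @` B) (f x) by exists x.
by rewrite -e => -[y By /fi <-].
Qed.

Lemma set_self T : T <~ set T.
Proof. by exists set1 => x y; rewrite predeqE => /(_ x)[/(_ erefl)]. Qed.

Lemma cantor T : ~ (set T <~ T).
Proof.
move=> [f fi].
pose A := [set x | exists B, f B = x /\ ~ B x].
have [AfA|nAfA] := pselect (A (f A)).
  by have [B [/fi eB]] := AfA; rewrite eB.
by apply: (nAfA); exists A.
Qed.

Lemma fun_le_set A B : (A -> B) <~ set (A * B)%type.
Proof.
exists (fun f => [set p | p.2 = f p.1]) => f g; rewrite predeqE => e.
by apply/funext => x; have [/(_ erefl)] := e (x, f x).
Qed.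

Lemma sigT_le N (X : N -> Type) T : (forall n, X n <~ T) -> {n & X n} <~ (N * T)%type.
Proof.
move=> H.
have [f fi] : exists f : forall n, X n -> T, forall n, injective (f n).
  by exists (fun n => projT1 (cid (H n))) => n; exact: projT2 (cid (H n)).
exists (fun p => (projT1 p, f _ (projT2 p))) => -[n x] [m y] /= [] e.
by move: y; rewrite -e => y /fi ->.
Qed.

Lemma finite_inj T (A : set T) : ~ (nat <~ sub A) -> finite_set A.
Proof.
move=> H; apply: contrapT => /infiniteP; rewrite card_le_sub => h.
by apply: H; apply: inj_le_trans h; exists (fun n => exist _ n I) => x y [].
Qed.

Lemma inj_finite T (A : set T) : finite_set A -> ~ (nat <~ sub A).
Proof.
move=> fA h; have : infinite_set A by apply/infiniteP/card_le_sub; apply: inj_le_trans h; exact: sub_le.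
by [].
Qed.

Lemma nat_prod T U : nat <~ (T * U)%type -> nat <~ T \/ nat <~ U.
Proof.
move=> h; apply: contrapT => /not_orP[hT hU].
have nn V : ~ (nat <~ V) -> finite_set [set: V].
  by move=> hV; apply: finite_inj => h'; apply: hV; apply: inj_le_trans h' _; exact: sub_le.
have := finite_setX (nn _ hT) (nn _ hU); rewrite setXTT => /inj_finite; apply.
by apply: inj_le_trans h _; exists (fun x => exist _ x I) => x y [].
Qed.

Lemma wf_recursion D (lt : D -> D -> Prop) (wf : well_founded lt) (V : D -> Type)
    (step : forall x, (forall y, lt y x -> V y) -> V x) :
  exists F : forall x, V x, forall x, F x = step x (fun y _ => F y).
Proof.
exists (Fix wf V step) => x; apply: Fix_eq => {}x f g H.
by congr step; apply: functional_extensionality_dep => y; apply: functional_extensionality_dep => h.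
Qed.

(** Recursion picks for each point a value not taken before. If none is left, [T] injects into the
    initial segment of that point, which the hypothesis on segments forbids. *)
Lemma wf_embed D (lt : D -> D -> Prop) (wf : well_founded lt) T :
  (forall x y, [\/ x = y, lt x y | lt y x]) ->
  (forall p, ~ (T <~ sub (fun q => lt q p))) -> D <~ T.
Proof.
move=> tot H; have [[p0]|nD] := pselect (inhabited D); last first.
  have nD' (x : D) : False by apply: nD; exists.
  by exists (fun x => False_rect T (nD' x)) => x; case: (nD' x).
have [t0] : inhabited T.
  apply: contrapT => nT; have nT' (x : T) : False by apply: nT; exists.
  by apply: (H p0); exists (fun x => False_rect _ (nT' x)) => x; case: (nT' x).
pose step (x : D) (g : forall y, lt y x -> T) : T :=
  if pselect (exists t, forall y h, g y h <> t) is left e then projT1 (cid e) else t0.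
have [F FE] := wf_recursion wf step.
have Fneq x y : lt y x -> F y <> F x.
  move=> h; rewrite [F x]FE /step; case: pselect => [e|ne].
    by move: (projT2 (cid e)) => /(_ y h).
  exfalso; apply: (H x); apply: (@rel_inj _ _ (fun t (q : sub (fun q => lt q x)) => F (sval q) = t)).
    move=> t; apply: contrapT => nt; apply: ne; exists t => z hz e.
    by apply: nt; exists (exist _ z hz).
  by move=> t t' u <- <-.
exists F => x y e; case: (tot x y) => // h; first by case: (Fneq _ _ h).
by case: (Fneq _ _ h).
Qed.

Lemma wf_preimage A B (lt : B -> B -> Prop) (f : A -> B) :
  well_founded lt -> well_founded (fun x y => lt (f x) (f y)).
Proof.
move=> wf x; move: {2}(f x) (erefl (f x)) => b; elim/(well_founded_ind wf): b x => b IH x e.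
by constructor => y; rewrite e => /IH; apply.
Qed.

Lemma wf_min D (lt : D -> D -> Prop) (wf : well_founded lt) (P : D -> Prop) x :
  P x -> exists m, P m /\ forall y, P y -> ~ lt y m.
Proof.
elim/(well_founded_ind wf): x => x IH Px.
have [[y [Py yx]]|n] := pselect (exists y, P y /\ lt y x); first exact: IH yx Py.
by exists x; split=> // y Py yx; apply: n; exists y.
Qed.

Section CardinalOrder.
Variable k : cardinal.
Implicit Types x y z : k.

Lemma cle_min (A : set k) x : A x -> exists m, A m /\ forall y, A y -> cle m y.
Proof.
move=> Ax; have [|m [[mA mlb] _]] := @cle_wo k [pred x | `[<A x>]].
  by exists x; apply/asboolP.
exists m; split; first by move: mA => /asboolP.
by move=> y Ay; apply: mlb; apply/asboolP.
Qed.

Lemma cle_refl x : cle x x.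
Proof. by have [m [-> /(_ _ erefl)]] := @cle_min (eq^~ x) x erefl. Qed.

Lemma cle_total x y : cle x y \/ cle y x.
Proof.
have [m [[->|->] h]] := @cle_min (fun z => z = x \/ z = y) x (or_introl erefl).
  by left; apply: h; right.
by right; apply: h; left.
Qed.

Lemma cle_anti x y : cle x y -> cle y x -> x = y.
Proof.
move=> xy yx; pose A := [pred z | `[<z = x \/ z = y>]].
have [|m [_ uniq]] := @cle_wo k A.
  by exists x; apply/asboolP; left.
have h z : z = x \/ z = y -> minimum_of (@cle k) A z.
  move=> zxy; split; first exact/asboolP.
  move=> t /asboolP.
  by case: zxy => ->; case=> -> //; rewrite cle_refl.
by rewrite -(uniq x) ?(uniq y) //; apply: h; [right|left].
Qed.

Lemma cltNge x y : clt x y <-> ~ cle y x.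
Proof. by split=> /negP. Qed.

Lemma cleNgt x y : cle x y <-> ~ clt y x.
Proof. by rewrite /clt; split=> [->//|/negP/negbNE]. Qed.

Lemma cltW x y : clt x y -> cle x y.
Proof. by case: (cle_total x y) => // h /cltNge. Qed.

Lemma cle_trans y x z : cle x y -> cle y z -> cle x z.
Proof.
move=> xy yz.
have [m [[e|[e|e]] h]] := @cle_min (fun t => t = x \/ t = y \/ t = z) x (or_introl erefl).
- by rewrite -e; apply: h; right; right.
- have yx : cle y x by rewrite -e; apply: h; left.
  by rewrite (cle_anti xy yx).
- have zy : cle z y by rewrite -e; apply: h; right; left.
  by rewrite -(cle_anti yz zy).
Qed.

Lemma clt_le_trans y x z : clt x y -> cle y z -> clt x z.
Proof. by move=> /cltNge xy yz; apply/cltNge => zx; apply: xy; apply: cle_trans yz zx. Qed.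

Lemma cle_lt_trans y x z : cle x y -> clt y z -> clt x z.
Proof. by move=> xy /cltNge yz; apply/cltNge => zx; apply: yz; apply: cle_trans zx xy. Qed.

Lemma clt_trans y x z : clt x y -> clt y z -> clt x z.
Proof. by move=> /cltW; apply: cle_lt_trans. Qed.

Lemma clt_irr x : ~ clt x x.
Proof. by move=> /cltNge; apply; exact: cle_refl. Qed.

Lemma clt_neq x y : clt x y -> x <> y.
Proof. by move=> h e; move: h; rewrite e => /clt_irr. Qed.

Lemma clt_or x y : [\/ x = y, clt x y | clt y x].
Proof.
have [h|h] := pselect (cle x y); last by constructor 3; apply/cltNge.
have [h'|h'] := pselect (cle y x); last by constructor 2; apply/cltNge.
by constructor 1; apply: cle_anti.
Qed.

Lemma cle_or_lt x y : cle x y \/ clt y x.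
Proof. by have [h|h] := pselect (cle x y); [left|right; apply/cltNge]. Qed.

Lemma cle_eqVlt x y : cle x y -> x = y \/ clt x y.
Proof. by case: (clt_or x y) => [|h|/cltNge]; [left|right|]. Qed.

Lemma clt_wf : well_founded (@clt k).
Proof.
move=> x; apply: contrapT => nx.
have [m [nm h]] := @cle_min (fun x => ~ Acc (@clt k) x) x nx.
apply: nm; constructor => y /cltNge ym; apply: contrapT => ny.
exact/ym/h.
Qed.

Definition cmax x y : k := if cle x y then y else x.
Lemma cmaxl x y : cle x (cmax x y).
Proof. by rewrite /cmax; case: ifP => // _; exact: cle_refl. Qed.
Lemma cmaxr x y : cle y (cmax x y).
Proof.
rewrite /cmax; case: ifP => [_|/negP h]; first exact: cle_refl.
by apply: cltW; apply/cltNge.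
Qed.

Definition seg x : set k := fun y => clt y x.

Lemma seg_initial x : ~ (k <~ sub (seg x)).
Proof.
move=> h; apply: (@cle_initial k x); apply/card_le_sub.
by apply: inj_le_trans h; exact: sub_le.
Qed.

Lemma embed_or T : k <~ T \/ exists x, T <~ sub (seg x).
Proof.
have [h|h] := pselect (exists x, T <~ sub (seg x)); [by right|left].
apply: (wf_embed clt_wf clt_or) => p hp; apply: h; by exists p.
Qed.

Lemma not_leP T : ~ (k <~ T) <-> exists x, T <~ sub (seg x).
Proof.
split; first by case: (embed_or T).
by move=> [x h] h'; apply: (@seg_initial x); apply: inj_le_trans h.
Qed.

Lemma seg_embed_or x T : sub (seg x) <~ T \/ exists2 y, clt y x & T <~ sub (seg y).
Proof.
have [h|h] := pselect (exists2 y, clt y x & T <~ sub (seg y)); [by right|left].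
have wf : well_founded (fun a b : sub (seg x) => clt (sval a) (sval b)).
  exact/wf_preimage/clt_wf.
apply: (wf_embed wf) => [a b|p hp].
  case: (clt_or (sval a) (sval b)) => [/sub_eq|h'|h'];
  by [constructor 1|constructor 2|constructor 3].
apply: h; exists (sval p); first exact: (svalP p).
apply: inj_le_trans hp _.
by apply: (@inj_sub _ _ _ (fun q => sval (sval q))) => [a b e|a];
  [apply: sub_eq; apply: sub_eq|exact: (svalP a)].
Qed.

End CardinalOrder.

Lemma card_of T : exists k : cardinal, T <~ k /\ k <~ T.
Proof.
have [R woR] := @well_ordering_principle {classic T}.
(* [A] is the longest initial segment none of whose points has [T] below it *)
pose A : set T := fun x => forall y, R y x -> ~ (T <~ sub (fun z : T => ~~ R y z)).
pose S : rel (sub A) := fun x y => R (sval x) (sval y).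
have mn (P : set T) x : P x -> exists m, P m /\ forall y, P y -> R m y.
  move=> Px; have [|m [[mP mlb] _]] := woR [pred x | `[<P x>]].
    by exists x; apply/asboolP.
  exists m; split; first by move: mP => /asboolP.
  by move=> y Py; apply: mlb; apply/asboolP.
have Rrefl x : R x x by have [m [-> /(_ _ erefl)]] := mn (eq^~ x) x erefl.
have Ranti x y : R x y -> R y x -> x = y.
  move=> xy yx; pose B := [pred z : {classic T} | `[<z = x \/ z = y>]].
  have [|m [_ uniq]] := woR B.
    by exists x; apply/asboolP; left.
  have h z : z = x \/ z = y -> minimum_of R B z.
    move=> zxy; split; first exact/asboolP.
    move=> t /asboolP.
    by case: zxy => ->; case=> ->.
  by rewrite -(uniq x) ?(uniq y) //; apply: h; [right|left].
have Rtot x y : R x y \/ R y x.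
  have [m [[->|->] h]] := mn (fun z => z = x \/ z = y) x (or_introl erefl).
    by left; apply: h; right.
  by right; apply: h; left.
have Rtr y x z : R x y -> R y z -> R x z.
  move=> xy yz.
  have [m [[e|[e|e]] h]] := mn (fun t => t = x \/ t = y \/ t = z) x (or_introl erefl).
  - by rewrite -e; apply: h; right; right.
  - have yx : R y x by rewrite -e; apply: h; left.
    by rewrite (Ranti _ _ xy yx).
  - have zy : R z y by rewrite -e; apply: h; right; left.
    by rewrite -(Ranti _ _ yz zy).
have Swo : well_order S.
  apply: antisymmetric_well_order => [x y /andP[xy yx]|P [x Px]].
    exact/sub_eq/Ranti.
  have [m [[p Pp pm] h]] := mn (fun t => exists2 p, P p & sval p = t) (sval x) (ex_intro2 _ _ x Px erefl).
  exists p; split=> // q Pq; rewrite /S pm; apply: h; by exists q.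
have TA : T <~ sub A.
  have [h|h] := pselect (forall x, A x).
    by apply: (@inj_sub _ _ _ id).
  have [x nAx] : exists x, ~ A x by apply: contrapT => h'; apply: h => x; apply: contrapT => ?; apply: h'; exists x.
  have [m [nAm hm]] := mn (fun x => ~ A x) x nAx.
  have [y [ym Ty]] : exists y, R y m /\ T <~ sub (fun z : T => ~~ R y z).
    apply: contrapT => h'; apply: nAm => y ym Ty; apply: h'; by exists y.
  apply: inj_le_trans Ty _; apply: sub_mono => z /negP yz t tz Tt.
  have ty : ~ A y by move=> /(_ t); apply => //; case: (Rtot t y) => // yt; case: yz; apply: Rtr tz.
  have zm : R m z by apply: hm => /(_ t tz).
  by apply: yz; apply: Rtr zm.
have Sin (x : sub A) : ~ ([set: sub A] #<= [set y : sub A | ~~ S x y]).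
  move=> /card_le_sub h; have := svalP x; move=> /(_ (sval x) (Rrefl _)); apply.
  apply: inj_le_trans TA _; apply: inj_le_trans (inj_le_trans _ h) _.
    by exists (fun x => exist _ x I) => a b [].
  by apply: (@inj_sub _ _ _ (fun q => sval (sval q))) => [a b e|a];
    [apply: sub_eq; apply: sub_eq|exact: (svalP a)].
by exists (Cardinal Swo Sin); split=> //=; exact: sub_le.
Qed.

Lemma inj_le_total T U : T <~ U \/ U <~ T.
Proof.
have [k [Tk kT]] := card_of T.
case: (embed_or k U) => [h|[x h]]; first by left; apply: inj_le_trans h.
by right; apply: inj_le_trans kT; apply: inj_le_trans h (sub_le _).
Qed.

Lemma not_inj_le T U : ~ (T <~ U) -> U <~ T.
Proof. by case: (inj_le_total T U). Qed.

Lemma card_wf : well_founded (fun k k' : cardinal => ~ (k' <~ k)).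
Proof.
have H (k : cardinal) (p : k) (k' : cardinal) : k' <~ sub (seg p) ->
    Acc (fun k k' : cardinal => ~ (k' <~ k)) k'.
  elim/(well_founded_ind (@clt_wf k)): p k' => p IH k' h.
  constructor => k'' n; case: (seg_embed_or p k'') => [h'|[q qp h']].
    by case: n; apply: inj_le_trans h'.
  exact: IH qp _ h'.
move=> k; constructor => k' /not_leP[p]; exact: H.
Qed.

Lemma card_min (P : cardinal -> Prop) k : P k ->
  exists k0, P k0 /\ forall k', P k' -> k0 <~ k'.
Proof.
move=> /(wf_min card_wf)[k0 [Pk0 h]]; exists k0; split=> // k' Pk'.
by apply: contrapT; exact: h.
Qed.

(** * Cardinal arithmetic and cofinalities *)

(** Shifting along a copy of [nat] frees the value [f 0]; sending a maximum [m] there would embed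
    the cardinal into the segment below [m]. *)
Lemma infinite_no_max (k : cardinal) : nat <~ k -> forall m : k, exists x, clt m x.
Proof.
move=> [f fi] m; apply: contrapT => nm.
have max x : cle x m by apply/cleNgt => h; apply: nm; exists x.
apply: (@seg_initial k m).
pose sh (x : k) : k := if pselect (exists n, f n = x) is left e then f (projT1 (cid e)).+1 else x.
have shi : injective sh.
  move=> x y; rewrite /sh; case: pselect => [e|e]; case: pselect => [e'|e'].
  - move=> /fi [] h.
    exact: etrans (esym (projT2 (cid e))) (etrans (congr1 f h) (projT2 (cid e'))).
  - by move=> h; case: e'; eexists; exact: h.
  - by move=> h; case: e; eexists; rewrite h.
  - by [].
have sh0 x : sh x <> f 0.
  rewrite /sh; case: pselect => [e /fi //|e h]; by apply: e; exists 0.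
pose sw (x : k) : k := if pselect (x = m) is left _ then f 0 else x.
apply: (@inj_sub _ _ _ (sw \o sh)) => [x y|x] /=; rewrite /sw.
  case: pselect => [e|e]; case: pselect => [e'|e'].
  - by rewrite -e' in e; move: e => /shi.
  - by move=> h; case: (sh0 y).
  - by move=> h; case: (sh0 x).
  - exact: shi.
rewrite /seg; case: pselect => [e|e].
  case: (clt_or (f 0) m) => // [h|h]; last by case: nm; eexists; exact: h.
  by move: (sh0 x); rewrite e h.
case: (clt_or (sh x) m) => // h; by case: nm; eexists; exact: h.
Qed.

Lemma sub_closed_lt (k : cardinal) (m : k) : nat <~ k -> ~ (k <~ sub (fun y => cle y m)).
Proof.
move=> ki h; have [x mx] := infinite_no_max ki m.
apply: (@seg_initial k x); apply: inj_le_trans h _; apply: sub_mono => y ym.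
exact: cle_lt_trans ym mx.
Qed.

(** The squaring laws are hypotheses on the two types, since the lemma serves in the induction that
    proves them in general. *)
Lemma prod_lt0 (k : cardinal) T U : nat <~ k ->
  (nat <~ T -> (T * T)%type <~ T) -> (nat <~ U -> (U * U)%type <~ U) ->
  ~ (k <~ T) -> ~ (k <~ U) -> ~ (k <~ (T * U)%type).
Proof.
move=> ki Tsq Usq nT nU h.
wlog TU : T U Tsq Usq nT nU h / T <~ U.
  move=> W; case: (inj_le_total T U) => H; first exact: (W _ _ Tsq Usq).
  apply: (W _ _ Usq Tsq) => //; apply: inj_le_trans h _.
  by exists (fun p => (p.2, p.1)) => -[a b] [c d] [] -> ->.
have [nU'|nU'] := pselect (nat <~ U).
  apply: nU; apply: inj_le_trans h _; apply: inj_le_trans (Usq nU').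
  exact: prod_mono TU (inj_le_refl _).
have := inj_le_trans ki h => /nat_prod[hT|//]; apply: nU'; exact: inj_le_trans hT TU.
Qed.

(** Pairs are well-ordered by maximum, then lexicographically. The predecessors of [p] lie in the
    square of the closed segment up to [mx p], which is small by induction. *)
Lemma card_sq (k : cardinal) : nat <~ k -> (k * k)%type <~ k.
Proof.
elim/(well_founded_ind card_wf): k => k IH ki.
pose mx (p : k * k) : k := cmax p.1 p.2.
pose lt (p q : k * k) : Prop :=
  clt (mx p) (mx q) \/ mx p = mx q /\ (clt p.1 q.1 \/ p.1 = q.1 /\ clt p.2 q.2).
have wf : well_founded lt.
  move=> p; move: {2}(mx p) (erefl (mx p)) => m.
  elim/(well_founded_ind (@clt_wf k)): m p => m IHm p; move: {2}(p.1) (erefl p.1) => a.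
  elim/(well_founded_ind (@clt_wf k)): a p => a IHa p; move: {2}(p.2) (erefl p.2) => b.
  elim/(well_founded_ind (@clt_wf k)): b p => b IHb p eb ea em.
  constructor => q [h|[h [h'|[h' h'']]]].
  - by apply: (IHm (mx q)) => //; rewrite -em.
  - by apply: (IHa q.1) => //; rewrite -?ea // h.
  - by apply: (IHb q.2) => //; rewrite -?eb // ?h ?h'.
apply: (wf_embed wf) => [p q|p].
  case: (clt_or (mx p) (mx q)) => [e|h|h]; [|by constructor 2; left|by constructor 3; left].
  case: (clt_or p.1 q.1) => [e1|h|h].
  - case: (clt_or p.2 q.2) => [e2|h|h].
    + by constructor 1; case: p q e1 e2 {e} => a b [c d] /= -> ->.
    + by constructor 2; right; split=> //; right.
    + by constructor 3; right; split=> //; right.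
  - by constructor 2; right; split=> //; left.
  - by constructor 3; right; split=> //; left.
pose X := sub (fun y : k => cle y (mx p)).
have nX : ~ (k <~ X) by exact: sub_closed_lt.
have Xsq : nat <~ X -> (X * X)%type <~ X.
  move=> Xi; have [k' [Xk' k'X]] := card_of X.
  apply: inj_le_trans (prod_mono Xk' Xk') _; apply: (inj_le_trans _ k'X).
  apply: IH; last exact: inj_le_trans Xi Xk'.
  by move=> h; apply: nX; apply: inj_le_trans h k'X.
move=> h; apply: (prod_lt0 ki Xsq Xsq nX nX); apply: inj_le_trans h _.
have H (q : sub (lt^~ p)) : cle (sval q).1 (mx p) /\ cle (sval q).2 (mx p).
  have qp : cle (mx (sval q)) (mx p).
    by case: (svalP q) => [/cltW//|[-> _]]; exact: cle_refl.
  by split; apply: cle_trans qp; [exact: cmaxl|exact: cmaxr].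
pose P := fun y : k => is_true (cle y (mx p)).
exists (fun q => (exist P _ (proj1 (H q)), exist P _ (proj2 (H q))) : X * X).
move=> a b [] e1 e2; apply: sub_eq; by case: (sval a) (sval b) e1 e2 => ? ? [? ?] /= -> ->.
Qed.

Lemma inj_le_sq T : nat <~ T -> (T * T)%type <~ T.
Proof.
move=> Ti; have [k [Tk kT]] := card_of T.
apply: inj_le_trans (prod_mono Tk Tk) _; apply: inj_le_trans kT.
by apply: card_sq; apply: inj_le_trans Ti Tk.
Qed.

Lemma inj_le_prod T U V : nat <~ V -> T <~ V -> U <~ V -> (T * U)%type <~ V.
Proof.
move=> Vi TV UV; apply: inj_le_trans (inj_le_sq Vi); exact: prod_mono.
Qed.

Lemma prod_lt (k : cardinal) T U : nat <~ k -> ~ (k <~ T) -> ~ (k <~ U) -> ~ (k <~ (T * U)%type).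
Proof. by move=> ki; apply: prod_lt0 => //; exact: inj_le_sq. Qed.

Lemma seq_le_nat_prod T : nat <~ T -> seq T <~ (nat * T)%type.
Proof.
move=> Ti; have [p pi] := inj_le_sq Ti; have [f fi] := Ti.
pose enc := foldr (fun x y => p (x, y)) (f 0).
exists (fun s => (size s, enc s)).
elim=> [|x s IH] [|y t] //= [] e /pi [] -> h; congr cons; apply: IH.
by rewrite e h.
Qed.

Lemma seq_le T V : nat <~ V -> T <~ V -> seq T <~ V.
Proof.
move=> Vi [f fi]; apply: (@inj_le_trans (seq V)).
  by exists (map f); exact: inj_map.
apply: inj_le_trans (seq_le_nat_prod Vi) _; apply: inj_le_prod => //; exact: inj_le_refl.
Qed.

Lemma sigT_le_prod N (X : N -> Type) V : nat <~ V -> N <~ V -> (forall n, X n <~ V) -> {n & X n} <~ V.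
Proof.
move=> Vi NV XV; apply: inj_le_trans (sigT_le XV) _; apply: inj_le_prod => //.
exact: inj_le_refl.
Qed.

Definition regular (C : cardinal) :=
  forall (N : Type) (z : N -> C), ~ (C <~ N) -> exists b, forall n, clt (z n) b.

(** Otherwise every fibre has a strict bound, and a common bound [w] of these fewer than [C] bounds
    lies itself in the fibre of [F w]. *)
Lemma regular_fiber (C : cardinal) (rC : regular C) N (F : C -> N) : ~ (C <~ N) ->
  exists n, C <~ sub (fun x => F x = n).
Proof.
move=> nN; apply: contrapT => H.
have /choice[b bP] n : exists b : C, forall x, F x = n -> clt x b.
  have nn : ~ (C <~ sub (fun x => F x = n)) by move=> h; apply: H; exists n.
  have [b bP] := rC _ (fun x : sub (fun x => F x = n) => sval x) nn.
  by exists b => x e; exact: (bP (exist _ x e)).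
have [w wP] := rC _ b nN.
by have := clt_trans (bP _ w erefl) (wP (F w)); move/clt_irr.
Qed.

Lemma regular_sigT (C : cardinal) (rC : regular C) N (X : N -> Type) : ~ (C <~ N) ->
  (forall n, ~ (C <~ X n)) -> ~ (C <~ {n & X n}).
Proof.
move=> nN nX [f fi]; have [n h] := regular_fiber rC (fun x => projT1 (f x)) nN.
apply: (nX n); apply: inj_le_trans h _.
apply: (@rel_inj _ _ (fun x y => f (sval x) = existT X n y)).
  move=> [x /= <-]; exists (projT2 (f x)); by case: (f x).
by move=> t t' u h h'; apply: sub_eq; apply: fi; rewrite h h'.
Qed.

Lemma regular_prod (C : cardinal) (rC : regular C) N X : ~ (C <~ N) ->
  ~ (C <~ X) -> ~ (C <~ (N * X)%type).
Proof.
move=> nN nX h; apply: (@regular_sigT _ rC N (fun _ => X) nN (fun _ => nX)).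
apply: inj_le_trans h _; by exists (fun p => existT (fun _ => X) p.1 p.2) => -[a b] [c d] /= [] -> ->.
Qed.

Lemma regular_unbounded (C : cardinal) (rC : regular C) N (z : N -> C) :
  (forall b, exists n, cle b (z n)) -> C <~ N.
Proof.
move=> H; apply: contrapT => /rC-/(_ z)[b bP].
by have [n] := H b; move/cleNgt; apply.
Qed.

Definition cofin (k : cardinal) (X : set k) N (z : N -> k) :=
  (forall n, X (z n)) /\ forall x, X x -> exists n, cle x (z n).

Lemma cofin_bound (k c : cardinal) (X : set k) :
  (forall N (z' : N -> k), cofin X z' -> c <~ N) ->
  forall M (h : M -> k), ~ (c <~ M) -> (forall n, X (h n)) ->
  exists x, X x /\ forall n, clt (h n) x.
Proof.
move=> min M h nM hX; apply: contrapT => H; apply: nM; apply: (min _ h); split=> // x Xx.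
apply: contrapT => H'; apply: H; exists x; split=> // n; apply/cltNge => xn.
by apply: H'; exists n.
Qed.

Lemma cofin_strict (k c : cardinal) (X : set k) (z : c -> k) : nat <~ c -> cofin X z ->
  (forall N (z' : N -> k), cofin X z' -> c <~ N) ->
  exists w : c -> k, forall t, X (w t) /\ forall s, cle s t -> clt (z s) (w t).
Proof.
move=> ci [zX zc] min.
suff H t : exists x, X x /\ forall s, cle s t -> clt (z s) x by have [w wP] := choice H; exists w.
have [x [Xx h]] := cofin_bound min (h := fun s : sub (fun s => cle s t) => z (sval s)) (sub_closed_lt ci) (fun s => zX _).
by exists x; split=> // s st; exact: (h (exist _ s st)).
Qed.

(** A family in [c] is bounded by bounding its image under [w] in [X] and taking an index [t] whose
    value [z t] lies above that bound. *)
Lemma cofin_regular (k c : cardinal) (X : set k) (z : c -> k) : nat <~ c -> cofin X z ->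
  (forall N (z' : N -> k), cofin X z' -> c <~ N) -> regular c.
Proof.
move=> ci zcof min N y nN; have [w wP] := cofin_strict ci zcof min.
have [x [Xx h]] := cofin_bound min (h := fun n => w (y n)) nN (fun n => proj1 (wP _)).
have [t xt] := (proj2 zcof) _ Xx; exists t => n; apply/cltNge => ty.
have := clt_trans (proj2 (wP (y n)) _ ty) (h n) => h1.
by have := clt_le_trans h1 xt => /clt_irr.
Qed.

(** The witness is the successor of the size of [T]: the least cardinal that does not embed in [T],
    which Cantor's theorem puts below [set T]. *)
Lemma regular_succ T : nat <~ T -> exists s : cardinal, [/\ regular s, ~ (s <~ T) & s <~ set T].
Proof.
move=> Ti; have [k0 [h1 h2]] := card_of (set T).
have nk0 : ~ (k0 <~ T) by move=> h; apply: (@cantor T); apply: inj_le_trans h1 h.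
have [s [ns smin]] := @card_min (fun k => ~ (k <~ T)) _ nk0.
exists s; split=> //; last exact: inj_le_trans (smin _ nk0) h2.
have sle X : ~ (s <~ X) -> X <~ T.
  move=> nX; apply: contrapT => nXT; apply: nX.
  have [x [Xx xX]] := card_of X; apply: inj_le_trans xX; apply: smin => h.
  by apply: nXT; apply: inj_le_trans Xx h.
have si : nat <~ s by apply: inj_le_trans Ti (not_inj_le ns).
move=> N z nN; apply: contrapT => H; apply: ns.
have unb b : exists n, cle b (z n).
  apply: contrapT => H'; apply: H; exists b => n; apply/cltNge => h; by apply: H'; exists n.
apply: (@inj_le_trans {n & sub (fun y => cle y (z n))}).
  apply: (@rel_inj _ _ (fun x p => x = sval (projT2 p))) => [x|x y p -> ->//].
  by have [n h] := unb x; exists (existT _ n (exist _ x h)).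
apply: sigT_le_prod => //; first exact: sle.
by move=> n; apply: sle; exact: sub_closed_lt.
Qed.

Lemma inj_surj T U : T <~ U -> U <~ T -> exists s : U -> T, forall t, exists u, s u = t.
Proof.
move=> [g gi] [h _].
exists (fun u => if pselect (exists t, g t = u) is left e then projT1 (cid e) else h u).
move=> t; exists (g t); case: pselect => [e|[]]; last by exists t.
exact: gi (projT2 (cid e)).
Qed.

Lemma inj_surj0 T U (t0 : T) : T <~ U -> exists s : U -> T, forall t, exists u, s u = t.
Proof.
move=> [g gi].
exists (fun u => if pselect (exists t, g t = u) is left e then projT1 (cid e) else t0).
move=> t; exists (g t); case: pselect => [e|[]]; last by exists t.
exact: gi (projT2 (cid e)).
Qed.

Lemma cofin_least (k : cardinal) (X : set k) : exists (c : cardinal) (z : c -> k),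
  cofin X z /\ forall N (z' : N -> k), cofin X z' -> c <~ N.
Proof.
have tr N (z : N -> k) (c : cardinal) : N <~ c -> c <~ N -> cofin X z -> exists z' : c -> k, cofin X z'.
  move=> Nc cN [zX zc]; have [s ss] := inj_surj Nc cN.
  exists (z \o s); split=> [n|x /zc[n xn]]; first exact: zX.
  by have [u su] := ss n; exists u; rewrite /= su.
have idc : cofin X (fun x : sub X => sval x).
  split=> [n|x Xx]; first exact: (svalP n).
  by exists (exist _ x Xx); exact: cle_refl.
have [c0 [h1 h2]] := card_of (sub X).
have [c [[z zc] min]] := @card_min (fun c => exists z : c -> k, cofin X z) _ (tr _ _ _ h1 h2 idc).
exists c, z; split=> // N z' z'c; have [c' [h h']] := card_of N.
exact: inj_le_trans (min _ (tr _ _ _ h h' z'c)) h'.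
Qed.

(** * Scales in products of regular cardinals *)

Section Product.
Variables (I : Type) (c : I -> cardinal).
Hypothesis I_inf : nat <~ I.
Hypothesis c_reg : forall i, regular (c i).
Hypothesis c_big : forall i, ~ (c i <~ set I).

Let c_inf i : nat <~ c i.
Proof.
apply: inj_le_trans I_inf (inj_le_trans (set_self I) _); exact: (not_inj_le (@c_big i)).
Qed.

Let setI_inf : nat <~ set I. Proof. exact: inj_le_trans I_inf (set_self I). Qed.

(** An upper bound for the cofinality of the product over [e]. All functions stay defined on the
    whole of [I], so that [e] can vary without changing types. *)
Definition cofam (e : set I) (N : Type) := exists G : N -> forall i, c i,
  forall g : (forall i, c i), exists n, forall i, e i -> cle (g i) (G n i).

Lemma psup N (H : N -> forall i, c i) : N <~ set I ->
  exists g : (forall i, c i), forall n i, clt (H n i) (g i).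
Proof.
move=> NI.
have B i : exists b : c i, forall n, clt (H n i) b.
  by apply: c_reg => h; apply: (@c_big i); apply: inj_le_trans h NI.
by exists (fun i => projT1 (cid (B i))) => n i; exact: (projT2 (cid (B i))).
Qed.

Lemma prod_point : exists p0 : (forall i, c i), True.
Proof.
by exists (fun i => projT1 (cid (@c_inf i)) 0).
Qed.

Lemma unit_le : unit <~ set I.
Proof. by apply: (@inj_le_trans nat) => //; exists (fun _ => 0) => -[] []. Qed.

Definition pmax (g h : forall i, c i) : forall i, c i := fun i => cmax (g i) (h i).

Lemma prod_update (i : I) (b : c i) : exists g : (forall i, c i), g i = b.
Proof.
have [p0 _] := prod_point.
exists (fun j => if pselect (i = j) is left E then eq_rect i (fun j => c j) b j E else p0 j).
by case: pselect => // E; rewrite (Prop_irrelevance E erefl).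
Qed.

Lemma cofam_surj e N N' (s : N' -> N) : (forall n, exists m, s m = n) -> cofam e N -> cofam e N'.
Proof.
move=> ss [G Gc]; exists (G \o s) => g; have [n h] := Gc g; have [m sm] := ss n.
by exists m; rewrite /= sm.
Qed.

Lemma cofam_le e N N' : N <~ N' -> cofam e N -> cofam e N'.
Proof.
move=> NN' ce; have [p0 _] := prod_point; have [G Gc] := ce; have [n0 _] := Gc p0.
have [s ss] := inj_surj0 n0 NN'; exact: cofam_surj ss ce.
Qed.

Lemma cofam_sub e e' N : e' `<=` e -> cofam e N -> cofam e' N.
Proof.
by move=> h [G Gc]; exists G => g; have [n hn] := Gc g; exists n => i /h; exact: hn.
Qed.

Lemma cofam_setU e e' (nu : cardinal) : nat <~ nu -> cofam e nu -> cofam e' nu -> cofam (e `|` e') nu.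
Proof.
move=> nui [G Gc] [G' Gc']; apply: (cofam_le (inj_le_sq nui)).
exists (fun p => pmax (G p.1) (G' p.2)) => g.
have [n h] := Gc g; have [m h'] := Gc' g; exists (n, m) => i [/h|/h'] H; apply: cle_trans H _.
  exact: cmaxl.
exact: cmaxr.
Qed.

(** Recursion along [k] joins a bound of the earlier stages modulo [J] with [G0 x]. It yields both
    the increasing family in the proof of directedness and the scales. *)
Lemma increasing_family (k : cardinal) (D : set k) (J : set I -> Prop) (G0 : k -> forall i, c i) :
  (forall a b, a `<=` b -> J b -> J a) ->
  (forall x, D x -> forall K : k -> forall i, c i,
    exists g : (forall i, c i), forall y, clt y x -> J (fun i => clt (g i) (K y i))) ->
  exists G : k -> forall i, c i, (forall x i, cle (G0 x i) (G x i)) /\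
    forall x, D x -> forall y, clt y x -> J (fun i => clt (G x i) (G y i)).
Proof.
move=> Jsub bnd; have [p0 _] := prod_point.
pose ext (x : k) (g : forall y, clt y x -> forall i, c i) : k -> forall i, c i :=
  fun y => if pselect (clt y x) is left h then g y h else p0.
pose P (x : k) (K : k -> forall i, c i) := exists g : (forall i, c i), forall y, clt y x -> J (fun i => clt (g i) (K y i)).
pose step (x : k) (g : forall y, clt y x -> forall i, c i) : forall i, c i :=
  pmax (if pselect (P x (ext x g)) is left e then projT1 (cid e) else p0) (G0 x).
have [G GE] := wf_recursion (@clt_wf k) step.
exists G; split=> [x i|x Dx y yx]; first by rewrite GE; exact: cmaxr.
rewrite [G x]GE /step; case: pselect => [e|[]]; last exact: bnd.
have := projT2 (cid e) y yx; apply: Jsub => i h.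
rewrite /ext; case: pselect => // yx'; apply: cle_lt_trans h; exact: cmaxl.
Qed.

(** * Directedness modulo the sets of small cofinality *)

Section Directed.
Variable nu : cardinal.
Hypothesis nu_big : set I <~ nu.
Let nu_inf : nat <~ nu. Proof. exact: inj_le_trans setI_inf nu_big. Qed.
Let J (e : set I) := cofam e nu.
Let leJ (g h : forall i, c i) := J (fun i => clt (h i) (g i)).

Let J0 : J set0.
Proof.
have [p0 _] := prod_point; have [f _] := nu_inf.
by exists (fun _ => p0) => g; exists (f 0).
Qed.

Let Jsub a b : a `<=` b -> J b -> J a. Proof. exact: cofam_sub. Qed.

(* If no bound existed, a strictly increasing chain of approximations indexed by [2^I]
   would pick pairwise distinct coordinates. *)
Let directed_step (D : set nu) : (forall x, D x -> forall y, clt y x -> D y) ->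
  (forall x, D x -> forall H : nu -> forall i, c i,
     exists g, forall y, clt y x -> leJ (H y) g) ->
  forall H : nu -> forall i, c i, exists g, forall y, D y -> leJ (H y) g.
Proof.
move=> Ddown IH H.
have [G [HG Ginc]] := increasing_family H Jsub IH.
suff [g gP] : exists g, forall x, D x -> leJ (G x) g.
  exists g => y Dy; apply: Jsub (gP y Dy) => i h; apply: clt_le_trans h _; exact: HG.
have Ginc' x y : D x -> cle y x -> leJ (G y) (G x).
  move=> Dx /cle_eqVlt[->|]; last exact: Ginc.
  by apply: Jsub J0 => i /clt_irr.
(* A cofinal part of size at most 2^I is bounded pointwise, so only long families remain. *)
have [[z [zD zc]]|nz] := pselect (exists z : set I -> nu,
    (forall s, D (z s)) /\ forall x, D x -> exists s, cle x (z s)).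
  have [g gP] := psup (fun s => G (z s)) (inj_le_refl _).
  exists g => x Dx; have [s xs] := zc x Dx.
  apply: Jsub (Ginc' _ _ (zD s) xs) => i h; exact: clt_trans (gP s i) h.
apply: contrapT => nG.
(* Assume that nothing bounds the family modulo [J]. Then every late member takes, at some
   coordinate, a value strictly between [g] and a further function [p.2]; if no such function
   existed, the dominating families for the sets in [J] would combine into one for the set [e] where
   [G x0] exceeds [g]. *)
have key g : exists p : nu * (forall i, c i), [/\ D p.1, forall i, cle (g i) (p.2 i) &
    forall x, D x -> cle p.1 x -> exists i, clt (g i) (G x i) /\ clt (G x i) (p.2 i)].
  have [x0 [Dx0 nx0]] : exists x0, D x0 /\ ~ leJ (G x0) g.
    apply: contrapT => h; apply: nG; exists g => x Dx; apply: contrapT => h'; apply: h; by exists x.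
  pose e : set I := fun i => clt (g i) (G x0 i).
  have [g' g'P] : exists g', forall x, D x -> ~ J (fun i => e i /\ clt (G x i) (g' i)).
    apply: contrapT => h; apply: nx0.
    have hg g' : exists x, D x /\ J (fun i => e i /\ clt (G x i) (g' i)).
      apply: contrapT => h'; apply: h; exists g' => x Dx Jx; apply: h'; by exists x.
    have [K KP] : exists K : set I -> nu -> forall i, c i, forall e', J e' ->
        forall g, exists n, forall i, e' i -> cle (g i) (K e' n i).
      have /choice[K KP] e' : exists K : nu -> forall i, c i, J e' ->
        forall g, exists n, forall i, e' i -> cle (g i) (K n i).
        have [[K KP]|h'] := pselect (J e'); first by exists K.
        by have [p0 _] := prod_point; exists (fun _ => p0).
      by exists K.
    change (J e); apply: (@cofam_le _ (nu * (set I * nu))%type).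
      apply: inj_le_prod => //; first exact: inj_le_refl.
      by apply: inj_le_prod => //; exact: inj_le_refl.
    exists (fun p i => if pselect (p.2.1 i) then K p.2.1 p.2.2 i else G p.1 i) => g'.
    have [x [Dx Jx]] := hg g'; have [n nP] := KP _ Jx g'.
    exists (x, ((fun i : I => e i /\ clt (G x i) (g' i)) : set I, n)) => i ei; case: pselect => [hi|ni]; first exact: nP.
    by apply/cleNgt => h''; apply: ni; split.
  exists (x0, pmax g g'); split=> //= [i|x Dx x0x]; first exact: cmaxl.
  apply: contrapT => ni; apply: (g'P x Dx); apply: Jsub (Ginc' _ _ Dx x0x) => i [ei h].
  rewrite /=; case: (cle_or_lt (G x0 i) (G x i)) => // h'; case: ni; exists i; split.
    exact: clt_le_trans ei h'.
  exact: clt_le_trans h (cmaxr _ _).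
have [nxt nxtP] := choice key.
(* Iterating [nxt] along an ordinal of size 2^I gives a chain [F] increasing at all coordinates. An
   [x] beyond all its thresholds selects for each stage a coordinate with a gap; gaps at one
   coordinate are disjoint, so 2^I would inject into [I]. *)
have [L [IL LI]] := card_of (set I).
have bd (x : L) (g : forall y, clt y x -> forall i, c i) :
    exists g' : (forall i, c i), forall y (h : clt y x) i, clt ((nxt (g y h)).2 i) (g' i).
  have [|g' g'P] := @psup (sub (seg x)) (fun y => (nxt (g (sval y) (proj2_sig y))).2).
    exact: inj_le_trans (sub_le _) LI.
  exists g' => y h i; exact: (g'P (exist _ y h)).
have [F FE] := wf_recursion (@clt_wf L) (fun x g => projT1 (cid (bd x g))).
have Fnxt x y : clt y x -> forall i, clt ((nxt (F y)).2 i) (F x i).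
  by move=> yx i; rewrite [F x]FE; exact: (projT2 (cid (bd x _)) y yx).
have [s ss] : exists s : set I -> L, forall a, exists u, s u = a by exact: inj_surj LI IL.
have [x [Dx xP]] : exists x, D x /\ forall u, clt (nxt (F (s u))).1 x.
  apply: contrapT => h; apply: nz; exists (fun u => (nxt (F (s u))).1); split=> [u|x Dx].
    by have [] := nxtP (F (s u)).
  apply: contrapT => h'; apply: h; exists x; split=> // u; apply/cltNge => h''; apply: h'; by exists u.
have /choice[f fP] a : exists i, clt (F a i) (G x i) /\ clt (G x i) ((nxt (F a)).2 i).
  have [_ _ h] := nxtP (F a); apply: h => //; have [u <-] := ss a; exact: cltW.
apply: (@cantor I); apply: inj_le_trans IL _; exists f => a b.
wlog ab : a b / clt a b => [W|e].
  by case: (clt_or a b) => // h e; [exact: W|apply/esym/W].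
have [_ h1] := fP a; have [h2 _] := fP b; rewrite -e in h2.
by have := clt_trans (clt_trans h1 (Fnxt _ _ ab _)) h2 => /clt_irr.
Qed.

Lemma directed N (H : N -> forall i, c i) : N <~ nu ->
  exists g : (forall i, c i), forall n, cofam (fun i => clt (g i) (H n i)) nu.
Proof.
have seg_dir x (H' : nu -> forall i, c i) : exists g, forall y, clt y x -> leJ (H' y) g.
  elim/(well_founded_ind (@clt_wf nu)): x H' => x IH H'.
  apply: directed_step => [y yx z zy|y yx K]; first exact: clt_trans zy yx.
  exact: IH.
move=> Nnu; have [p0 _] := prod_point.
have [[n0]|nN] := pselect (inhabited N); last first.
  by exists p0 => n; case: nN; exists.
have [s ss] := inj_surj0 n0 Nnu.
have [g gP] := @directed_step setT (fun _ _ _ _ => Logic.I) (fun x _ => seg_dir x) (H \o s).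
by exists g => n; have [m <-] := ss n; exact: (gP m Logic.I).
Qed.

End Directed.

(** * The cofinality of a subproduct and its scale *)

Section Tau.
Variable e : set I.

Lemma tau_ex : exists k : cardinal, cofam e k /\ forall k' : cardinal, cofam e k' -> k <~ k'.
Proof.
have [k0 [h _]] := card_of (forall i, c i).
apply: (@card_min _ k0); apply: cofam_le h _; exists id => g; exists g => i _; exact: cle_refl.
Qed.

Definition tau : cardinal := projT1 (cid tau_ex).
Lemma tau_cofam : cofam e tau. Proof. exact: (proj1 (projT2 (cid tau_ex))). Qed.
Lemma tau_min N : cofam e N -> tau <~ N.
Proof.
move=> h; have [k [Nk kN]] := card_of N.
by apply: inj_le_trans kN; apply: (proj2 (projT2 (cid tau_ex))); apply: cofam_le h.
Qed.

Lemma tau_ge i : e i -> c i <~ tau.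
Proof.
move=> ei; have [G Gc] := tau_cofam; apply: (regular_unbounded (@c_reg i) (z := fun n => G n i)) => b.
by have [g <-] := prod_update b; have [n h] := Gc g; exists n; exact: h.
Qed.

(** The pcf ideal of sets of cofinality below [tau]. Its witnesses are kept above [set I], the range
    in which [directed] gives bounds. *)
Definition Jt (a : set I) := exists nu : cardinal, [/\ set I <~ nu, ~ (tau <~ nu) & cofam a nu].

Lemma Jt_sub a b : a `<=` b -> Jt b -> Jt a.
Proof. by move=> ab [nu [h1 h2 h3]]; exists nu; split=> //; exact: cofam_sub h3. Qed.

Lemma Jt_setU a b : Jt a -> Jt b -> Jt (a `|` b).
Proof.
move=> [nu [h1 h2 h3]] [nu' [h1' h2' h3']].
case: (inj_le_total nu nu') => h; [exists nu'|exists nu]; split=> //; apply: cofam_setU => //;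
  try exact: cofam_le h _; exact: inj_le_trans setI_inf _.
Qed.

Lemma Jt_self : ~ Jt e.
Proof. by move=> [nu [_ h1 h2]]; apply: h1; exact: tau_min. Qed.

Lemma Jt_tau : forall a, Jt a -> exists2 nu : cardinal, cofam a nu & ~ (tau <~ nu).
Proof. by move=> a [nu [_ h1 h2]]; exists nu. Qed.

Hypothesis e0 : exists i, e i.

Lemma tau_big : ~ (tau <~ set I).
Proof.
move=> h; have [i ei] := e0; apply: (@c_big i); exact: inj_le_trans (tau_ge ei) h.
Qed.

Lemma Jt_bound N (H : N -> forall i, c i) : ~ (tau <~ N) ->
  exists g : (forall i, c i), forall n, Jt (fun i => clt (g i) (H n i)).
Proof.
move=> nN.
have [M [NM IM nM]] : exists M, [/\ N <~ M, set I <~ M & ~ (tau <~ M)].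
  case: (inj_le_total N (set I)) => h; [exists (set I)|exists N]; split=> //; try exact: inj_le_refl.
  exact: tau_big.
have [nu [Mnu nuM]] := card_of M.
have [g gP] := directed (inj_le_trans IM Mnu) H (inj_le_trans NM Mnu).
exists g => n; exists nu; split=> //; first exact: inj_le_trans IM Mnu.
by move=> h; apply: nM; apply: inj_le_trans h nuM.
Qed.

(** A dominating family of least size is made increasing modulo [Jt] by enlarging its members, which
    keeps it dominating. *)
Lemma scale_ex : exists S : tau -> forall i, c i,
  (forall g : (forall i, c i), exists x, forall i, e i -> cle (g i) (S x i)) /\
  forall x y, clt y x -> Jt (fun i => clt (S x i) (S y i)).
Proof.
have [G Gc] := tau_cofam.
have [x _ K|S [GS Sinc]] := @increasing_family tau setT Jt G Jt_sub.
  have [g gP] := @Jt_bound _ (fun y : sub (seg x) => K (sval y)) (@seg_initial _ x).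
  by exists g => y yx; exact: (gP (exist _ y yx)).
exists S; split=> [g|x y]; last exact: Sinc.
by have [n h] := Gc g; exists n => i /h H; apply: cle_trans H (GS _ _).
Qed.

Definition scale : tau -> forall i, c i := projT1 (cid scale_ex).
Lemma scale_cofinal (g : forall i, c i) : exists x, forall i, e i -> cle (g i) (scale x i).
Proof. exact: (proj1 (projT2 (cid scale_ex))). Qed.
Lemma scale_lt x y : clt y x -> Jt (fun i => clt (scale x i) (scale y i)).
Proof. exact: (proj2 (projT2 (cid scale_ex))). Qed.

(** If [y] came before [x], then [e] itself would belong to [Jt], as [scale x] is below [scale y] on
    all of [e]. A point of [e] excludes [x = y]. *)
Lemma scale_above (g : forall i, c i) x y :
  (forall i, e i -> clt (scale x i) (g i)) -> (forall i, e i -> cle (g i) (scale y i)) -> clt x y.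
Proof.
move=> h1 h2; apply/cltNge => /cle_eqVlt[yx|yx].
  have [i ei] := e0; have := clt_le_trans (h1 i ei) (h2 i ei); by rewrite yx => /clt_irr.
by apply: Jt_self; apply: Jt_sub (scale_lt yx) => i ei; exact: clt_le_trans (h1 i ei) (h2 i ei).
Qed.

(** A bound modulo [Jt] of the given scale members is itself dominated by a member [x]. If some
    [z n] passed beyond [x], the set [e] would be covered by two sets in [Jt]. *)
Lemma tau_regular : regular tau.
Proof.
move=> N z nN; have [g gP] := Jt_bound (fun n => scale (z n)) nN.
have [g1 g1P] := @psup unit (fun _ => g) unit_le.
have [x xP] := scale_cofinal g1.
have [g2 g2P] := @psup unit (fun _ => scale x) unit_le.
have [y yP] := scale_cofinal g2.
have xy : clt x y by apply: scale_above yP => i _; exact: (g2P tt i).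
exists y => n; apply: cle_lt_trans xy; apply/cleNgt => xz.
apply: Jt_self; apply: Jt_sub (Jt_setU (gP n) (scale_lt xz)) => i ei.
case: (cle_or_lt (scale (z n) i) (g i)) => h; [right|by left].
by apply: cle_lt_trans h _; apply: clt_le_trans (g1P tt i) (xP i ei).
Qed.

End Tau.
End Product.

(** * Sets of exact cofinality from strongly unbounded sequences *)

Section Exact.
Variables (I : Type) (c : I -> cardinal) (th : cardinal).
Hypothesis I_inf : nat <~ I.
Hypothesis c_reg : forall i, regular (c i).
Hypothesis c_big : forall i, ~ (c i <~ set I).
Hypothesis th_reg : regular th.
Hypothesis th_big : ~ (th <~ set I).

(** A bound [g] modulo the sets of cofinality at most [th] leaves only the sets where a member
    exceeds [g]. One such set [e] occurs [th] times; were its cofinality smaller, one function would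
    dominate [th] members on [e] and hence, joined with [g], everywhere. *)
Lemma exact_cofinality (k : th -> forall i, c i) :
  (forall l : (forall i, c i), ~ (th <~ sub (fun x => forall i, cle (k x i) (l i)))) ->
  exists e, cofam c e th /\ forall N, ~ (th <~ N) -> ~ cofam c e N.
Proof.
move=> SU; apply: contrapT => H.
have small e : cofam c e th -> exists N, ~ (th <~ N) /\ cofam c e N.
  move=> ce; apply: contrapT => H'; apply: H; exists e; split=> // N nN cN; apply: H'; by exists N.
have [g gP] := directed I_inf c_reg c_big (not_inj_le th_big) k (inj_le_refl th).
have [e [p pi]] := regular_fiber th_reg (fun x => (fun i => clt (g i) (k x i)) : set I) th_big.
have [x0 _] : exists x0 : th, True.
  by have [f _] := inj_le_trans I_inf (inj_le_trans (set_self I) (not_inj_le th_big)); exists (f 0).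
have [N [nN [G Gc]]] : exists N, ~ (th <~ N) /\ cofam c e N.
  apply: small; have := gP (sval (p x0)); by rewrite (svalP (p x0)).
have [n nP] := choice (fun x => Gc (k (sval (p x)))).
have [n0 [q qi]] := regular_fiber th_reg n nN.
apply: (SU (pmax g (G n0))); apply: (@inj_sub _ _ _ (fun x => sval (p (sval (q x))))) => [x y /sub_eq/pi/sub_eq/qi//|x i].
case: (cle_or_lt (k (sval (p (sval (q x)))) i) (g i)) => h; first by apply: cle_trans h (cmaxl _ _).
apply: cle_trans (cmaxr _ _).
have ei : e i by rewrite -[e](svalP (p (sval (q x)))).
by have := nP (sval (q x)) i ei; rewrite (svalP (q x)).
Qed.
End Exact.

(** * Closed points over two levels of subproducts *)

Section Good.
Variables (V : Type) (C : V -> cardinal) (sg : cardinal).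
Hypothesis C_reg : forall v, regular (C v).
Hypothesis C_sg : forall v, ~ (C v <~ sg).
Hypothesis sg_reg : regular sg.
Hypothesis sg_inf : nat <~ sg.
Variable R : (forall v, C v) -> (forall v, C v) -> Prop.

(** The chain replaces an increasing chain of elementary submodels: [R] is the closure required from
    one stage to the next, and [X] is the coordinatewise supremum. *)
Definition good (X : forall v, C v) := exists Z : sg -> forall v, C v,
  [/\ forall a b, clt a b -> R (Z a) (Z b), forall a v, cle (Z a v) (X v) &
      forall v y, clt y (X v) -> exists a, clt y (Z a v)].

Hypothesis R_next : forall Z, exists W : (forall v, C v),
  forall Z', (forall v, cle (W v) (Z' v)) -> R Z Z'.

Lemma good_above Z0 : exists X, good X /\ forall v, cle (Z0 v) (X v).
Proof.
have [nxt nxtP] := choice R_next.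
have bd (a : sg) (g : forall b, clt b a -> forall v, C v) :
    exists W : (forall v, C v), forall v, cle (Z0 v) (W v) /\ forall b h, cle (nxt (g b h) v) (W v).
  have h v : exists w, cle (Z0 v) w /\ forall b h, cle (nxt (g b h) v) w.
    have [|w wP] := @C_reg v (sub (seg a)) (fun b => nxt (g _ (proj2_sig b)) v).
      by move=> h; apply: (@C_sg v); apply: inj_le_trans h (sub_le _).
    exists (cmax (Z0 v) w); split=> [|b h]; first exact: cmaxl.
    by apply: cle_trans (cmaxr _ _); exact/cltW/(wP (exist _ b h)).
  by exists (fun v => projT1 (cid (h v))) => v; exact: (projT2 (cid (h v))).
have [Z ZE] := wf_recursion (@clt_wf sg) (fun a g => projT1 (cid (bd a g))).
have ZP a v : cle (Z0 v) (Z a v) /\ forall b, clt b a -> cle (nxt (Z b) v) (Z a v).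
  by rewrite [Z a]ZE; exact: (projT2 (cid (bd a _)) v).
have lub v : exists x, (forall a, cle (Z a v) x) /\ forall y, clt y x -> exists a, clt y (Z a v).
  have [w wP] := @C_reg v _ (fun a => Z a v) (@C_sg v).
  have [x [xP xmin]] := @cle_min (C v) (fun x => forall a, cle (Z a v) x) w (fun a => cltW (wP a)).
  exists x; split=> // y /cltNge yx; apply: contrapT => H; apply: yx; apply: xmin => a.
  by apply/cleNgt => h; apply: H; exists a.
exists (fun v => projT1 (cid (lub v))); split.
  exists Z; split=> [a b ab|a v|v]; [|exact: (proj1 (projT2 (cid (lub v))))|exact: (proj2 (projT2 (cid (lub v))))].
  by apply: nxtP => v; exact: (proj2 (ZP b v)).
move=> v; have [f _] := sg_inf; apply: (@cle_trans _ (Z (f 0) v)); first exact: (proj1 (ZP _ v)).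
exact: (proj1 (projT2 (cid (lub v)))).
Qed.

Hypothesis R_lt : forall Z Z', R Z Z' -> forall v, clt (Z v) (Z' v).

(** The two chains interleave at [v]. As [I] is small, one stage of the chain of [Y] exceeds [X] at
    all coordinates in question; it is dominated by some [S x] with [x] below [Y v = X v], and a
    stage of the chain of [X] passes [x] at [v]. The scale member there is bounded by [X], so it is
    below [S x] on the whole set. *)
Lemma good_exact_lt (v : V) (I : Type) (iota : I -> V) (s : set I)
    (S : C v -> forall i, C (iota i)) (J : set I -> Prop) X Y :
  ~ (sg <~ I) -> (forall a b, a `<=` b -> J b -> J a) ->
  (forall Z Z', R Z Z' -> (forall i, s i -> cle (S (Z v) i) (Z' (iota i))) /\
     exists2 x, cle x (Z' v) & forall i, s i -> cle (Z (iota i)) (S x i)) ->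
  (forall x y, clt y x -> J (fun i => clt (S x i) (S y i))) ->
  good X -> good Y -> X v = Y v -> J (fun i => s i /\ clt (X (iota i)) (Y (iota i))).
Proof.
move=> nI Jsub Rr Sinc [ZX [ZXR ZXle ZXlub]] [ZY [ZYR ZYle ZYlub]] XY.
pose e : set I := fun i => s i /\ clt (X (iota i)) (Y (iota i)).
have [f _] := sg_inf.
have /choice[j jP] i : exists a, e i -> clt (X (iota i)) (ZY a (iota i)).
  have [[si /ZYlub[a h]]|n] := pselect (e i); [by exists a|by exists (f 0)].
have [a aP] := sg_reg j nI.
have [a' aa'] := infinite_no_max sg_inf a; have [a'' aa''] := infinite_no_max sg_inf a'.
have [_ [x xle xP]] := Rr _ _ (ZYR _ _ aa').
have xY : clt x (Y v).
  apply: cle_lt_trans xle _; exact: clt_le_trans (R_lt (ZYR _ _ aa'') v) (ZYle _ _).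
have [b xb] : exists b, clt x (ZX b v) by apply: ZXlub; rewrite XY.
have [b' bb'] := infinite_no_max sg_inf b.
have [SX _] := Rr _ _ (ZXR _ _ bb').
apply: Jsub (Sinc _ _ xb) => i [si h].
apply: cle_lt_trans (SX i si) _; apply: cle_lt_trans (ZXle _ _) _.
apply: clt_le_trans (jP i (conj si h)) _; apply: cle_trans (xP i si).
exact/cltW/R_lt/ZYR/aP.
Qed.

End Good.

(** * Points over factors, subproducts and families of subproducts *)

Section TwoLevel.
Variables (ka : Type) (c : ka -> cardinal).
Hypothesis ka_inf : nat <~ ka.
Hypothesis c_reg : forall i, regular (c i).
Hypothesis c_big : forall i, ~ (c i <~ set (set (set ka))).

Let ska_inf : nat <~ set ka. Proof. exact: inj_le_trans ka_inf (set_self _). Qed.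
Let c_big1 i : ~ (c i <~ set ka).
Proof.
move=> h; apply: (@c_big i); apply: inj_le_trans h _.
exact: inj_le_trans (set_self _) (set_self _).
Qed.

(* The empty set is replaced by the full one, so that all cofinalities below are infinite. *)
Definition fill (T : Type) (e : set T) : set T := if pselect (exists i, e i) then e else setT.
Lemma fillE T (e : set T) : (exists i, e i) -> fill e = e.
Proof. by rewrite /fill; case: pselect. Qed.
Let fill1 (e : set ka) : exists i, fill e i.
Proof.
by rewrite /fill; case: pselect => [|n] //; have [f _] := ka_inf; exists (f 0).
Qed.
Let fill2 (e : set (set ka)) : exists i, fill e i.
Proof. by rewrite /fill; case: pselect => [|n] //; exists set0. Qed.

Definition tau1 (e : set ka) : cardinal := tau ka_inf c_big1 (fill e).

Lemma tau1_reg e : regular (tau1 e). Proof. exact: tau_regular. Qed.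
Lemma tau1_big3 e : ~ (tau1 e <~ set (set (set ka))).
Proof.
have [i ei] := fill1 e; move=> h; apply: (@c_big i).
by apply: inj_le_trans h; exact: tau_ge.
Qed.
Lemma tau1_big e : ~ (tau1 e <~ set (set ka)).
Proof. by move=> h; apply: (@tau1_big3 e); apply: inj_le_trans h (set_self _). Qed.

Definition scale1 e : tau1 e -> forall i, c i := @scale ka c ka_inf c_reg c_big1 (fill e) (fill1 e).
Definition J1 e : set (set ka) := Jt ka_inf c_big1 (fill e).

Definition tau2 (u : set (set ka)) : cardinal := tau ska_inf tau1_big (fill u).
Lemma tau2_reg u : regular (tau2 u). Proof. exact (@tau_regular _ tau1 ska_inf tau1_reg tau1_big (fill u) (fill2 u)). Qed.
Lemma tau2_big3 u : ~ (tau2 u <~ set (set (set ka))).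
Proof.
have [e ue] := fill2 u; move=> h; apply: (@tau1_big3 e).
apply: inj_le_trans h; exact (@tau_ge _ tau1 ska_inf tau1_reg tau1_big _ _ ue).
Qed.
Definition scale2 u : tau2 u -> forall e, tau1 e := @scale _ tau1 ska_inf tau1_reg tau1_big (fill u) (fill2 u).
Definition J2 u : set (set (set ka)) := Jt ska_inf tau1_big (fill u).

(* A point gives simultaneously values in the factors [c i], on the scales of the
   subproducts [e], and on the scales of the families [u] of subproducts. *)
Definition node : Type := (ka + set ka + set (set ka))%type.
Definition ncard (v : node) : cardinal :=
  match v with inl (inl i) => c i | inl (inr e) => tau1 e | inr u => tau2 u end.
Definition n0 (i : ka) : node := inl (inl i).
Definition n1 (e : set ka) : node := inl (inr e).
Definition n2 (u : set (set ka)) : node := inr u.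

Lemma ncard_reg v : regular (ncard v).
Proof. by case: v => [[i|e]|u] /=; [exact: c_reg|exact: tau1_reg|exact: tau2_reg]. Qed.
Lemma ncard_big v : ~ (ncard v <~ set (set (set ka))).
Proof. by case: v => [[i|e]|u] /=; [exact: c_big|exact: tau1_big3|exact: tau2_big3]. Qed.

(** Each scale condition goes both ways: the later point dominates the scale member at the earlier
    index, and some index up to the later value gives a member dominating the earlier point. *)
Definition closes (Z Z' : forall v, ncard v) :=
  [/\ forall v, clt (Z v) (Z' v),
   forall e : set ka, (forall i, fill e i -> cle (scale1 (Z (n1 e)) i) (Z' (n0 i))) /\
     exists2 x : tau1 e, cle x (Z' (n1 e)) & forall i, fill e i -> cle (Z (n0 i)) (scale1 x i) &
   forall u : set (set ka), (forall e, fill u e -> cle (scale2 (Z (n2 u)) e) (Z' (n1 e))) /\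
     exists2 x : tau2 u, cle x (Z' (n2 u)) & forall e, fill u e -> cle (Z (n1 e)) (scale2 x e)].

Lemma closes_lt Z Z' : closes Z Z' -> forall v, clt (Z v) (Z' v).
Proof. by case. Qed.

Lemma ncard_bound v N (z : N -> ncard v) (x : ncard v) : N <~ set (set ka) ->
  exists b, (forall n, clt (z n) b) /\ clt x b.
Proof.
move=> NV.
have big M : M <~ set (set ka) -> ~ (ncard v <~ M).
  move=> h h'; apply: (@ncard_big v); apply: inj_le_trans h' (inj_le_trans h (set_self _)).
have [b bP] := ncard_reg z (big _ NV).
have [b' b'P] : exists b', forall n : unit, clt ((fun _ => x) n) b'.
  apply: ncard_reg; apply: big; apply: inj_le_trans (set_self _).
  exact: unit_le.
exists (cmax b b'); split=> [n|]; first exact: clt_le_trans (bP n) (cmaxl _ _).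
exact: clt_le_trans (b'P tt) (cmaxr _ _).
Qed.

(** A factor meets up to [set ka] many scales and a subproduct up to [set (set ka)] many; the
    cardinals at the nodes exceed both numbers, so all the values at one coordinate have a common
    bound. *)
Lemma closes_next Z : exists W : (forall v, ncard v),
  forall Z', (forall v, cle (W v) (Z' v)) -> closes Z Z'.
Proof.
have b0 i := ncard_bound (v := n0 i) (fun e : set ka => scale1 (Z (n1 e)) i) (Z (n0 i)) (set_self _).
have x1 e : exists x : tau1 e, forall i, fill e i -> cle (Z (n0 i)) (scale1 x i).
  exact: (@scale_cofinal _ _ ka_inf c_reg c_big1 _ (fill1 e) (fun i => Z (n0 i))).
have b1 e := ncard_bound (v := n1 e) (fun u : set (set ka) => scale2 (Z (n2 u)) e)
  (cmax (Z (n1 e)) (projT1 (cid (x1 e)))) (inj_le_refl _).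
have x2 u : exists x : tau2 u, forall e, fill u e -> cle (Z (n1 e)) (scale2 x e).
  exact: (@scale_cofinal _ _ ska_inf tau1_reg tau1_big _ (fill2 u) (fun e => Z (n1 e))).
(* No scale passes through [n2 u], so the family to be bounded is a dummy constant. *)
have b2 u := ncard_bound (v := n2 u) (fun n : set (set ka) => Z (n2 u))
  (cmax (Z (n2 u)) (projT1 (cid (x2 u)))) (inj_le_refl _).
exists (fun v => match v return ncard v with
  | inl (inl i) => projT1 (cid (b0 i))
  | inl (inr e) => projT1 (cid (b1 e))
  | inr u => projT1 (cid (b2 u)) end) => Z' ZZ'.
have H0 i := projT2 (cid (b0 i)); have H1 e := projT2 (cid (b1 e)); have H2 u := projT2 (cid (b2 u)).
split=> [[[i|e]|u]|e|u].
- exact: clt_le_trans (proj2 (H0 i)) (ZZ' (n0 i)).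
- apply: clt_le_trans (ZZ' (n1 e)); exact: cle_lt_trans (cmaxl _ _) (proj2 (H1 e)).
- apply: clt_le_trans (ZZ' (n2 u)); exact: cle_lt_trans (cmaxl _ _) (proj2 (H2 u)).
- split=> [i ei|]; first by apply: cltW; exact: clt_le_trans (proj1 (H0 i) e) (ZZ' (n0 i)).
  exists (projT1 (cid (x1 e))); last exact: (projT2 (cid (x1 e))).
  apply: cle_trans (ZZ' (n1 e)); apply: cltW; exact: cle_lt_trans (cmaxr _ _) (proj2 (H1 e)).
- split=> [e ue|]; first by apply: cltW; exact: clt_le_trans (proj1 (H1 e) u) (ZZ' (n1 e)).
  exists (projT1 (cid (x2 u))); last exact: (projT2 (cid (x2 u))).
  apply: cle_trans (ZZ' (n2 u)); apply: cltW; exact: cle_lt_trans (cmaxr _ _) (proj2 (H2 u)).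
Qed.

Lemma chain_ex : exists s : cardinal, [/\ regular s, ~ (s <~ set ka) & s <~ set (set ka)].
Proof. exact: regular_succ. Qed.
(** Long enough that stages chosen for all factors or all subproducts have a common bound, short
    enough that limits of the chain exist at every node. *)
Definition chain : cardinal := projT1 (cid chain_ex).
Lemma chain_reg : regular chain. Proof. by have [] := projT2 (cid chain_ex). Qed.
Lemma chain_big : ~ (chain <~ set ka). Proof. by have [] := projT2 (cid chain_ex). Qed.
Lemma chain_inf : nat <~ chain. Proof. exact: inj_le_trans ska_inf (not_inj_le chain_big). Qed.
Lemma ncard_chain v : ~ (ncard v <~ chain).
Proof.
have [_ _ h] := projT2 (cid chain_ex); move=> h'; apply: (@ncard_big v).
exact: inj_le_trans h' (inj_le_trans h (set_self _)).
Qed.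

(* Closed points are limits of [chain]-sequences closed under all the scales; hence two of them
   that agree at a subproduct agree at its factors modulo the ideal of smaller cofinality. *)
Definition closed_node : set (forall v, ncard v) := good chain closes.

Lemma closed_above Z : exists X, closed_node X /\ forall v, cle (Z v) (X v).
Proof. exact: (good_above ncard_reg ncard_chain chain_inf closes_next). Qed.

Lemma closed_eq1 e X Y : (exists i, e i) -> closed_node X -> closed_node Y -> X (n1 e) = Y (n1 e) ->
  J1 e (fun i => e i /\ X (n0 i) <> Y (n0 i)).
Proof.
move=> ne gX gY XY.
have H X' Y' : closed_node X' -> closed_node Y' -> X' (n1 e) = Y' (n1 e) -> J1 e (fun i => e i /\ clt (X' (n0 i)) (Y' (n0 i))).
  move=> gX' gY' e'; apply: (good_exact_lt chain_reg chain_inf closes_lt (v := n1 e)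
    (iota := n0) (s := e) (S := @scale1 e) (J := J1 e)) gX' gY' e'.
  - by move=> h; apply: chain_big; apply: inj_le_trans h (set_self _).
  - exact: Jt_sub.
  - by move=> Z Z' [_ /(_ e) + _]; rewrite fillE.
  - move=> x y; exact: scale_lt.
apply: Jt_sub (Jt_setU (H _ _ gX gY XY) (H _ _ gY gX (esym XY))) => i [ei].
by case: (clt_or (X (n0 i)) (Y (n0 i))) => // h _; [left|right].
Qed.

Lemma closed_eq2 u X Y : (exists e, u e) -> closed_node X -> closed_node Y -> X (n2 u) = Y (n2 u) ->
  J2 u (fun e => u e /\ X (n1 e) <> Y (n1 e)).
Proof.
move=> nu gX gY XY.
have H X' Y' : closed_node X' -> closed_node Y' -> X' (n2 u) = Y' (n2 u) -> J2 u (fun e => u e /\ clt (X' (n1 e)) (Y' (n1 e))).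
  move=> gX' gY' e'; apply: (good_exact_lt chain_reg chain_inf closes_lt (v := n2 u)
    (iota := n1) (s := u) (S := @scale2 u) (J := J2 u)) gX' gY' e'.
  - exact: chain_big.
  - exact: Jt_sub.
  - by move=> Z Z' [_ _ /(_ u)]; rewrite fillE.
  - move=> x y; exact: scale_lt.
apply: Jt_sub (Jt_setU (H _ _ gX gY XY) (H _ _ gY gX (esym XY))) => i [ei].
by case: (clt_or (X (n1 i)) (Y (n1 i))) => // h _; [left|right].
Qed.

Lemma tau1_min e N : (exists i, e i) -> cofam c e N -> tau1 e <~ N.
Proof.
move=> ne h; apply: (@tau_min _ c ka_inf c_big1 (fill e) N); by rewrite fillE.
Qed.

Lemma tau2_min u N : (exists e, u e) -> cofam tau1 u N -> tau2 u <~ N.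
Proof.
move=> nu h; apply: (@tau_min _ tau1 ska_inf tau1_big (fill u) N); by rewrite fillE.
Qed.

(** Exceptional sets have strictly smaller cofinality; this is the measure that decreases in the
    induction on [e]. *)
Lemma J1_tau e w : (exists i, w i) -> J1 e w -> ~ (tau1 e <~ tau1 w).
Proof.
move=> nw /Jt_tau[nu h1 h2] h; apply: h2; apply: inj_le_trans h _; exact: tau1_min.
Qed.

Lemma J2_tau u w : (exists i, w i) -> J2 u w -> ~ (tau2 u <~ tau2 w).
Proof.
move=> nw /Jt_tau[nu h1 h2] h; apply: h2; apply: inj_le_trans h _; exact: tau2_min.
Qed.

Lemma tau1_ge (e : set ka) i : e i -> c i <~ tau1 e.
Proof.
move=> ei; apply: (@tau_ge _ c ka_inf c_reg c_big1 (fill e) i).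
by rewrite fillE //; exists i.
Qed.

(** The witness [q e] is an index at which the scale of [e] dominates [g]. This lifts a dominating
    family for the factors to one for the cofinalities of subproducts. *)
Lemma tau1_unbounded (g : forall i, c i) : exists q : (forall e, tau1 e),
  (forall e, (exists i, e i) -> forall i, e i -> cle (g i) (scale1 (q e) i)) /\
  forall e (x : tau1 e), (forall i, fill e i -> clt (scale1 x i) (g i)) -> clt x (q e).
Proof.
have h e := @scale_cofinal _ _ ka_inf c_reg c_big1 _ (fill1 e) g.
exists (fun e => projT1 (cid (h e))); split=> [e ne i ei|e x xP].
  by apply: (projT2 (cid (h e))); rewrite fillE.
apply: (@scale_above _ _ ka_inf c_reg c_big1 _ (fill1 e) g); first exact: xP.
exact: (projT2 (cid (h e))).
Qed.

End TwoLevel.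

(** * The branching tree *)

Lemma no_decreasing_seq (k : cardinal) (s : nat -> k) : ~ (forall n, clt (s n.+1) (s n)).
Proof.
move=> h; have [m [[n <-] /(_ (s n.+1))]] := wf_min (@clt_wf k) (ex_intro (fun n => s n = s 0) 0 erefl : (fun x => exists n, s n = x) (s 0)).
by apply; [exists n.+1|].
Qed.

Section Pcf.
Variables (mu ka th : cardinal).
Hypothesis mu_inf : nat <~ mu.
Hypothesis mu_lim : forall T, ~ (mu <~ T) -> ~ (mu <~ set T).
Hypothesis ka_reg : regular ka.
Hypothesis ka_unc : ~ (ka <~ nat).
Hypothesis ka_mu : ~ (mu <~ ka).
Hypothesis ka_cof : exists w : ka -> mu, forall x, exists d, cle x (w d).
Hypothesis ka_min : forall N (z : N -> mu), ~ (ka <~ N) -> exists b, forall n, clt (z n) b.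
Hypothesis th_reg : regular th.
Hypothesis th_mu : ~ (th <~ mu).
Hypothesis th_pow : th <~ set mu.

Let mlt (T : Type) := ~ (mu <~ T).

Let mlt_le T U : T <~ U -> mlt U -> mlt T.
Proof. by move=> TU nU h; apply: nU; exact: inj_le_trans h TU. Qed.

Let mlt_prod T U : mlt T -> mlt U -> mlt (T * U)%type.
Proof. exact: prod_lt. Qed.

Let mlt_fun T U : mlt T -> mlt U -> mlt (T -> U).
Proof. by move=> hT hU; apply: mlt_le (fun_le_set T U) _; apply/mu_lim/mlt_prod. Qed.

Let mlt_mu T : mlt T -> T <~ mu. Proof. exact: not_inj_le. Qed.

Let le_mu_th T : T <~ mu -> ~ (th <~ T).
Proof. by move=> h h'; apply: th_mu; exact: inj_le_trans h' h. Qed.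

Let mlt_th T : mlt T -> ~ (th <~ T). Proof. by move=> /mlt_mu; exact: le_mu_th. Qed.

Let mlt_seg (x : mu) : mlt (sub (seg x)). Proof. exact: seg_initial. Qed.

Let ka_inf : nat <~ ka. Proof. exact: not_inj_le ka_unc. Qed.
Let mu_th : mu <~ th. Proof. exact: not_inj_le th_mu. Qed.
Let th_inf : nat <~ th. Proof. exact: inj_le_trans mu_inf mu_th. Qed.

Let mlt_seg_le T : mlt T -> exists b : mu, T <~ sub (seg b).
Proof. by case: (embed_or mu T). Qed.

Let seg_mono (x y : mu) : cle x y -> sub (seg x) <~ sub (seg y).
Proof. by move=> xy; apply: sub_mono => z zx; exact: clt_le_trans zx xy. Qed.

Lemma trace_code (X : set mu) (b : mu) : (forall y, X y -> clt y b) ->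
  exists E : set mu -> mu, (exists b', forall A, clt (E A) b') /\
    forall A B, E A = E B <-> (forall y, X y -> (A y <-> B y)).
Proof.
move=> Xb; have : mlt (set (sub X)).
  apply: mu_lim; apply: (mlt_le _ (mlt_seg (x := b))); exact: sub_mono.
move=> /mlt_seg_le[b' [F Fi]].
pose r (A : set mu) : set (sub X) := fun y => A (sval y).
exists (fun A => sval (F (r A))); split; first by exists b' => A; exact: (svalP (F (r A))).
move=> A B; split.
  move=> /sub_eq/Fi e y Xy; have : r A (exist _ y Xy) = r B (exist _ y Xy) by rewrite e.
  by rewrite /r /= => ->.
move=> h; congr (sval (F _)); apply/funext => -[y Xy]; apply/propext; exact: h.
Qed.

Lemma levels_ex : exists m : ka -> mu, [/\ forall x, exists d, cle x (m d),
  forall d d', clt d d' -> clt (m d) (m d') &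
  forall d d', clt d d' -> set (sub (seg (m d))) <~ sub (seg (m d'))].
Proof.
have [w wc] := ka_cof.
have bd (d : ka) (g : forall d', clt d' d -> mu) : exists b, cle (w d) b /\
    forall d' h, clt (g d' h) b /\ set (sub (seg (g d' h))) <~ sub (seg b).
  have /choice[q qP] (p : sub (seg d)) : exists b : mu, set (sub (seg (g _ (proj2_sig p)))) <~ sub (seg b).
    exact/mlt_seg_le/mu_lim/mlt_seg.
  have [b1 b1P] := ka_min (fun p : sub (seg d) => g _ (proj2_sig p)) (@seg_initial _ d).
  have [b2 b2P] := ka_min q (@seg_initial _ d).
  exists (cmax (w d) (cmax b1 b2)); split; first exact: cmaxl.
  move=> d' h; split.
    apply: clt_le_trans (b1P (exist _ d' h)) _; apply: cle_trans (cmaxr _ _); exact: cmaxl.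
  apply: inj_le_trans (qP (exist _ d' h)) _; apply: seg_mono; apply: cltW.
  apply: clt_le_trans (b2P _) _; apply: cle_trans (cmaxr _ _); exact: cmaxr.
have [m mE] := wf_recursion (@clt_wf ka) (fun d g => projT1 (cid (bd d g))).
have mP d : cle (w d) (m d) /\
    forall d', clt d' d -> clt (m d') (m d) /\ set (sub (seg (m d'))) <~ sub (seg (m d)).
  by rewrite [m d]mE; exact: (projT2 (cid (bd d _))).
exists m; split=> [x|d d' h|d d' h].
- have [d h] := wc x; exists d; exact: cle_trans h (proj1 (mP d)).
- exact: (proj1 (proj2 (mP d') d h)).
- exact: (proj2 (proj2 (mP d') d h)).
Qed.

Definition level : ka -> mu := projT1 (cid levels_ex).
Lemma level_cofinal x : exists d, cle x (level d).
Proof. by have [+ _ _] := projT2 (cid levels_ex); apply. Qed.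
Lemma level_lt d d' : clt d d' -> clt (level d) (level d').
Proof. by have [_ + _] := projT2 (cid levels_ex); apply. Qed.
Lemma level_pow d d' : clt d d' -> set (sub (seg (level d))) <~ sub (seg (level d')).
Proof. by have [_ _ +] := projT2 (cid levels_ex); apply. Qed.
Lemma level_le d d' : cle d d' -> cle (level d) (level d').
Proof. by move=> /cle_eqVlt[->|/level_lt/cltW//]; exact: cle_refl. Qed.
Lemma ka_next (d : ka) : exists d', clt d d'. Proof. exact: infinite_no_max. Qed.
Lemma level_above x : exists d, clt x (level d).
Proof.
have [d h] := level_cofinal x; have [d' h'] := ka_next d; exists d'.
exact: cle_lt_trans h (level_lt h').
Qed.

(** The traces of [th] distinct subsets of [mu] on the levels, coded in [mu], are dominated [th]
    times by a function [h] that is minimal modulo tails. From [d1] on the codes are strictly below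
    [h d] and are measured in the cofinality of [h d]; a common bound of [th] measures would give a
    function below [h] on a tail that still dominates [th] times. *)
Lemma strongly_unbounded : exists c : ka -> cardinal,
  [/\ forall i, regular (c i), forall i, ~ (c i <~ set (set (set ka))),
      forall i, exists d, c i <~ sub (seg (level d)) &
  exists k : th -> forall i, c i, forall l : (forall i, c i),
    ~ (th <~ sub (fun x => forall i, cle (k x i) (l i)))].
Proof.
have [f fi] := th_pow.
have /choice[E EP] (d : ka) := @trace_code (seg (level d)) (level d) (fun y h => h).
pose v (d : ka) (x : th) : mu := E d (f x).
pose B (h : ka -> mu) := th <~ sub (fun x => forall d, cle (v d x) (h d)).
(* In an infinite descent modulo tails, the regular uncountable [ka] has a [d] beyond all
   thresholds, at which the values would descend forever. *)
have [h [Bh hmin]] : exists h, B h /\ forall h', B h' -> ~ exists d0, forall d, cle d0 d -> clt (h' d) (h d).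
  have [h0 Bh0] : exists h, B h.
    have /choice[h hP] d : exists b, forall x, clt (v d x) b.
      by have [[b bP] _] := EP d; exists b => x; exact: bP.
    exists h; apply: (@inj_sub _ _ _ id) => // x d; exact/cltW/hP.
  apply: contrapT => H.
  have nxt (p : sub B) : exists q : sub B, exists d0, forall d, cle d0 d -> clt (sval q d) (sval p d).
    apply: contrapT => H'; apply: H; exists (sval p); split; first exact: (svalP p).
    by move=> h' Bh' H''; apply: H'; exists (exist _ h' Bh').
  have [g gP] := choice nxt.
  pose s n := iter n g (exist _ h0 Bh0).
  have /choice[t tP] n : exists d0, forall d, cle d0 d -> clt (sval (s n.+1) d) (sval (s n) d) by exact: gP.
  have [d dP] := ka_reg t ka_unc.
  by apply: (@no_decreasing_seq _ (fun n => sval (s n) d)) => n; apply: tP; exact/cltW/dP.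
have [p0 p0i] := Bh.
have [e0 [p1 p1i]] := regular_fiber th_reg (fun x : th => (fun d => v d (sval (p0 x)) = h d) : set ka)
  (mlt_th (mu_lim ka_mu)).
pose q1 (x : th) : th := sval (p0 (sval (p1 x))).
have q1i : injective q1 by move=> x y /sub_eq/p0i/sub_eq/p1i.
have q1h x d : cle (v d (q1 x)) (h d) by exact: (svalP (p0 (sval (p1 x)))).
have q1e x d : e0 d <-> v d (q1 x) = h d by rewrite -[e0](svalP (p1 x)).
(* Equality with [h] at unboundedly many levels would make the traces of two members equal there,
   and the two subsets of [mu] would coincide. *)
have [d1 d1P] : exists d1, forall d, cle d1 d -> ~ e0 d.
  apply: contrapT => H.
  have unb d1 : exists d, cle d1 d /\ e0 d.
    apply: contrapT => H'; apply: H; exists d1 => d dd e; apply: H'; by exists d.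
  have [a ai] := th_inf.
  have : a 0 <> a 1 by move/ai.
  apply; apply: q1i; apply: fi; apply/funext => y; apply/propext.
  have [d yd] := level_above y; have [d' [dd' e]] := unb d.
  have : v d' (q1 (a 0)) = v d' (q1 (a 1)) by rewrite (proj1 (q1e _ _) e) (proj1 (q1e _ _) e).
  by move=> /(proj2 (EP d') _ _); apply; apply: clt_le_trans yd (level_le dd').
have q1lt x d : cle d1 d -> clt (v d (q1 x)) (h d).
  move=> dd; case: (cle_eqVlt (q1h x d)) => // /q1e; by case/(d1P d dd).
pose cl d := cofin_least (k := mu) (seg (h d)).
pose C d : cardinal := projT1 (cid (cl d)).
pose z d : C d -> mu := projT1 (cid (projT2 (cid (cl d)))).
have zc d : cofin (seg (h d)) (z d) by exact: (proj1 (projT2 (cid (projT2 (cid (cl d)))))).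
have Cmin d : forall N (z' : N -> mu), cofin (seg (h d)) z' -> C d <~ N
  by exact: (proj2 (projT2 (cid (projT2 (cid (cl d)))))).
pose low d := C d <~ set (set (set ka)).
have Cinf d : ~ low d -> nat <~ C d.
  move=> nl; apply: inj_le_trans ka_inf _; apply: inj_le_trans (set_self _) _.
  apply: inj_le_trans (set_self _) _; apply: inj_le_trans (set_self _) _; exact: not_inj_le.
have /choice[K KP] x : exists K : forall d, cle d1 d -> C d, forall d h, cle (v d (q1 x)) (z d (K d h)).
  exists (fun d h => projT1 (cid ((proj2 (zc d)) _ (q1lt x d h)))) => d h'.
  exact: (projT2 (cid ((proj2 (zc d)) _ (q1lt x d h')))).
pose lowcode x (d : ka) : set (set (set ka)) :=
  match pselect (cle d1 d), pselect (low d) with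
  | left h, left l => projT1 (cid l) (K x d h)
  | _, _ => set0 end.
have nlow : mlt (set (set (set ka))) by do 3!apply: mu_lim.
(* Where the cofinality is low, the measures form fewer than [mu] patterns; one pattern is kept. *)
have [k0 [p2 p2i]] := regular_fiber th_reg lowcode (mlt_th (mlt_fun ka_mu nlow)).
pose q2 (x : th) : th := sval (p2 x).
have q2low x y d (hd : cle d1 d) : low d -> K (q2 x) d hd = K (q2 y) d hd.
  move=> ld; have : lowcode (q2 x) d = lowcode (q2 y) d.
    by have := svalP (p2 x); have := svalP (p2 y) => /= -> ->.
  rewrite /lowcode; case: pselect => // hd'; case: pselect => // l.
  rewrite (Prop_irrelevance hd' hd); exact: (projT2 (cid l)).
have [x0 _] : exists x0 : th, True by have [a _] := th_inf; exists (a 0).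
pose good d := cle d1 d /\ ~ low d.
(* [zz] is the new bound below [h], which contradicts the minimality of [h] *)
have reduce (zz : ka -> mu) : (forall d, good d -> clt (zz d) (h d)) ->
    ~ (th <~ sub (fun x => forall d, good d -> cle (v d (q1 (q2 x))) (zz d))).
  move=> zzh [p3 p3i].
  pose h' d := match pselect (cle d1 d) with
    | left hd => if pselect (low d) is left _ then z d (K (q2 x0) d hd) else zz d
    | right _ => h d end.
  apply: (hmin h'); last first.
    exists d1 => d dd; rewrite /h'; case: pselect => // hd.
    case: pselect => [l|nl]; [exact: (proj1 (zc d))|exact: zzh].
  apply: (@inj_sub _ _ _ (fun x => q1 (q2 (sval (p3 x))))) => [x y /q1i/sub_eq/p2i/sub_eq/p3i //|x d].
  rewrite /h'; case: pselect => // hd; case: pselect => [l|nl].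
    by rewrite -(q2low (sval (p3 x)) x0 d hd l); exact: KP.
  exact: (svalP (p3 x)).
have [i0 gi0] : exists i0, good i0.
  apply: contrapT => H; apply: (reduce h) => [d gd|]; first by case: H; exists d.
  by apply: (@inj_sub _ _ _ id) => // x d gd; case: H; exists d.
(* The remaining coordinates repeat a fixed good one, so that every index in [ka] carries a large
   regular factor. *)
have /choice[r rP] (d : ka) : exists r, good r /\ (good d -> r = d).
  by have [gd|ngd] := pselect (good d); [exists d|exists i0].
have rd d : cle d1 (r d) by case: (rP d) => -[].
have rl d : ~ low (r d) by case: (rP d) => -[].
exists (fun d => C (r d)); split=> [d|d|d|].
- exact: cofin_regular (Cinf _ (rl d)) (zc _) (@Cmin _).
- exact: rl.
- have [d' h'] := level_cofinal (h (r d)); exists d'.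
  apply: inj_le_trans (seg_mono h'); apply: (Cmin _ _ (fun y : sub (seg (h (r d))) => sval y)).
  split=> [n|x xs]; first exact: (svalP n).
  by exists (exist _ x xs); exact: cle_refl.
exists (fun x d => K (q2 x) (r d) (rd d)) => l.
have /choice[zz zzP] d : exists w, clt w (h (r d)) /\ forall s, cle s (l d) -> clt (z (r d) s) w.
  by have [w wP] := cofin_strict (Cinf _ (rl d)) (zc _) (@Cmin _); exists (w (l d)); exact: wP.
move=> [p3 p3i]; apply: (reduce zz) => [d gd|].
  by have := proj1 (zzP d); have -> := proj2 (rP d) gd.
apply: (@inj_sub _ _ _ (fun x => sval (p3 x))) => [x y /sub_eq/p3i//|x d gd].
apply: cltW; apply: cle_lt_trans (proj2 (zzP d) _ (svalP (p3 x) d)).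
have e := proj2 (rP d) gd; move: (rd d); rewrite e => hd; exact: KP.
Qed.

Lemma restriction_code (J : Type) (T : J -> cardinal) (D : set J) (M : Type) :
  (forall e, D e -> T e <~ M) ->
  exists code : (forall e, T e) -> set (J * M)%type,
    forall f g, code f = code g <-> forall e, D e -> f e = g e.
Proof.
move=> TM.
have j e : exists h : D e -> T e -> M, forall De, injective (h De).
  exists (fun De => projT1 (cid (TM e De))) => De; exact: (projT2 (cid (TM e De))).
pose cd (f : forall e, T e) : set (J * M)%type :=
  fun p => exists De : D p.1, projT1 (cid (j p.1)) De (f p.1) = p.2.
exists cd => f g; split=> [fg e De|fg].
  apply: (projT2 (cid (j e)) De).
  have : cd f (e, projT1 (cid (j e)) De (f e)) by exists De.
  by rewrite fg => -[/= De' <-]; rewrite (Prop_irrelevance De' De).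
by apply/funext => -[e m]; apply/propext; split=> -[/= De <-]; exists De => /=; rewrite fg.
Qed.

(** The supremum of a countable sequence of closure steps is taken; it stays inside [ka] since [ka]
    is regular and uncountable. *)
Lemma ka_closure (b : ka -> ka) : exists d, [/\ exists d', clt d' d,
  forall d', clt d' d -> exists d'', clt d' d'' /\ clt d'' d & forall r, clt r d -> clt (b r) d].
Proof.
have /choice[nxt nxtP] d : exists d', clt d d' /\ forall r, cle r d -> clt (b r) d'.
  have [d1 d1P] := ka_reg (fun r : sub (fun r => cle r d) => b (sval r)) (sub_closed_lt (m := d) ka_inf).
  have [d2 d2P] := ka_next (cmax d d1); exists d2; split; first exact: cle_lt_trans (cmaxl _ _) d2P.
  move=> r rd; apply: clt_trans (d1P (exist _ r rd)) _; exact: cle_lt_trans (cmaxr _ _) d2P.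
have [f _] := ka_inf; pose s n := iter n nxt (f 0).
have [u uP] := ka_reg s ka_unc.
have [d [dP dmin]] := @cle_min ka (fun d => forall n, cle (s n) d) u (fun n => cltW (uP n)).
have slt n : clt (s n) d.
  apply: clt_le_trans (dP n.+1); exact: (proj1 (nxtP (s n))).
have sup r : clt r d -> exists n, cle r (s n).
  move=> rd; apply: contrapT => H; move/cltNge: rd; apply; apply: dmin => n.
  by apply: cltW; apply/cltNge => h; apply: H; exists n.
exists d; split; first by exists (s 0).
  move=> r /sup[n rn]; exists (s n.+1); split; last exact: slt.
  exact: cle_lt_trans rn (proj1 (nxtP (s n))).
move=> r /sup[n rn]; apply: clt_trans (slt n.+1); exact: (proj2 (nxtP (s n))).
Qed.

Definition limit (d : ka) := (exists d', clt d' d) /\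
  forall d', clt d' d -> exists d'', clt d' d'' /\ clt d'' d.

Definition discrete (A : set ka) := [/\ forall d, A d -> limit d,
  forall d, exists d', clt d d' /\ A d' &
  forall d, A d -> exists k, clt k d /\ forall a, A a -> clt a d -> cle a k].

(** * Localization of the cofinality at a discrete set of levels *)

Section Localize.
Variables (c : ka -> cardinal) (e0 : set ka).
Hypothesis c_reg : forall i, regular (c i).
Hypothesis c_big : forall i, ~ (c i <~ set (set (set ka))).
Hypothesis c_lev : forall i, exists d, c i <~ sub (seg (level d)).
Hypothesis e0_th : cofam c e0 th.
Hypothesis e0_min : forall N, ~ (th <~ N) -> ~ cofam c e0 N.

Let c_big1 i : ~ (c i <~ set ka).
Proof.
move=> h; apply: (@c_big i); apply: inj_le_trans h _.
exact: inj_le_trans (set_self _) (set_self _).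
Qed.

Local Notation T1 := (tau1 ka_inf c_big).
Local Notation T2 := (tau2 ka_inf c_reg c_big).
Local Notation point := (forall v, ncard ka_inf c_reg c_big v).
Local Notation n0 := (@n0 ka).
Local Notation n1 := (@n1 ka).
Local Notation n2 := (@n2 ka).
Local Notation closed_node := (@closed_node ka c ka_inf c_reg c_big).

Let mlt_ska : mlt (set ka). Proof. exact: mu_lim. Qed.
Let mlt_sska : mlt (set (set ka)). Proof. exact: mu_lim. Qed.

Definition below (d : ka) : set ka :=
  fun i => e0 i /\ exists e, clt e d /\ c i <~ sub (seg (level e)).
Definition unb (d : ka) (e : set ka) :=
  e `<=` below d /\ forall d', clt d' d -> ~ (e `<=` below d').
Definition family (A : set ka) : set (set ka) := fun e => exists d, A d /\ unb d e.

Lemma below_mono d d' : cle d d' -> below d `<=` below d'.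
Proof.
by move=> dd i [ei [e [ed h]]]; split=> //; exists e; split=> //; exact: clt_le_trans ed dd.
Qed.

Lemma unb_nonempty d e : limit d -> unb d e -> exists i, e i.
Proof.
move=> [[d' d'd] _] [_ /(_ _ d'd) H]; apply: contrapT => ne; apply: H => i ei.
by case: ne; exists i.
Qed.

Lemma point_ex : exists X : point, True.
Proof.
exists (fun v => projT1 (cid (not_inj_le (@ncard_big _ _ ka_inf c_reg c_big v))) set0).
by [].
Qed.
Definition pt0 : point := projT1 (cid point_ex).

(* Modulo [J1 e] (resp. [J2 u]) a closed point is determined on [e] (resp. [u]) by its value
   there; [rest1] and [rest2] record the exceptional set, of smaller cofinality. *)
Definition rep1 (e : set ka) (x : T1 e) : point :=
  if pselect (exists Y : point, closed_node Y /\ Y (n1 e) = x) is left h then projT1 (cid h) else pt0.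
Definition rep2 (u : set (set ka)) (x : T2 u) : point :=
  if pselect (exists Y : point, closed_node Y /\ Y (n2 u) = x) is left h then projT1 (cid h) else pt0.
Definition rest1 (X : point) (e : set ka) : set ka :=
  fun i => e i /\ X (n0 i) <> rep1 (X (n1 e)) (n0 i).
Definition rest2 (X : point) (u : set (set ka)) : set (set ka) :=
  fun e => u e /\ X (n1 e) <> rep2 (X (n2 u)) (n1 e).

Lemma rest1_J X e : closed_node X -> (exists i, e i) -> J1 ka_inf c_big e (rest1 X e).
Proof.
move=> cX ne; rewrite /rest1 /rep1; case: pselect => [h|[]]; last by exists X.
have [cY e'] := projT2 (cid h); exact: closed_eq1 ne cX cY (esym e').
Qed.

Lemma rest2_J X u : closed_node X -> (exists e, u e) -> J2 ka_inf c_reg c_big u (rest2 X u).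
Proof.
move=> cX ne; rewrite /rest2 /rep2; case: pselect => [h|[]]; last by exists X.
have [cY e'] := projT2 (cid h); exact: closed_eq2 ne cX cY (esym e').
Qed.

Definition determined (X : point) (d r : ka) (e : set ka) := forall Y : point, closed_node Y ->
  rest1 Y = rest1 X -> (forall e', unb d e' -> X (n1 e') = Y (n1 e')) ->
  (forall i, below r i -> X (n0 i) = Y (n0 i)) -> forall i, e i -> X (n0 i) = Y (n0 i).

(** Induction on the cofinality of [e]. If [e] is unbounded at [d], the value at [n1 e] decides
    every coordinate outside the exceptional set, whose cofinality is smaller. The descent stops at
    a set that is bounded below [d], which gives [r], or at one without exceptions, where any [r]
    below [d] serves. *)
Lemma determined_ex X d e : closed_node X -> limit d -> e `<=` below d ->
  exists r, clt r d /\ determined X d r e.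
Proof.
move=> cX ld.
elim/(well_founded_ind (wf_preimage T1 card_wf)): e => e IH ed.
have [[d' [d'd ed']]|nd] := pselect (exists d', clt d' d /\ e `<=` below d').
  by exists d'; split=> // Y _ _ _ h i ei; apply: h; exact: ed'.
have ue : unb d e by split=> // d' d'd ed'; apply: nd; exists d'.
have ne := unb_nonempty ld ue.
have step Y i : rest1 Y = rest1 X -> X (n1 e) = Y (n1 e) -> e i -> ~ rest1 X e i -> X (n0 i) = Y (n0 i).
  move=> eqr eqe ei nr.
  have nr' : ~ rest1 Y e i by rewrite eqr.
  have -> : X (n0 i) = rep1 (X (n1 e)) (n0 i) by apply: contrapT => h; apply: nr.
  rewrite eqe; apply: esym; by apply: contrapT => h; apply: nr'.
have [nw|ew] := pselect (exists i, rest1 X e i).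
  have [||r [rd rP]] := IH (rest1 X e).
  - by apply: J1_tau => //; exact: rest1_J.
  - by move=> i [/ed].
  exists r; split=> // Y cY eqr equ eqb i ei.
  have [h|h] := pselect (rest1 X e i); first exact: rP.
  by apply: step => //; exact: equ.
have [r rd] := proj1 ld; exists r; split=> // Y cY eqr equ eqb i ei.
by apply: step => //; [exact: equ|move=> h; apply: ew; exists i].
Qed.

(* Pressing down: the bounds [r < d] given by [determined_ex] are constant on an unbounded
   set of [d], whose isolated points form a discrete set. *)
Lemma determined_discrete X : closed_node X -> exists p : ka * set ka, discrete p.2 /\
  forall d, p.2 d -> determined X d p.1 (below d).
Proof.
move=> cX.
(* If each [r] failed beyond some [b r], a limit level closed under [b] would contradict
   [determined_ex]; this plays the part of Fodor's lemma. *)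
have [r rP] : exists r, forall b, exists d, [/\ clt b d, limit d & determined X d r (below d)].
  apply: contrapT => H.
  have /choice[b bP] r : exists b, forall d, clt b d -> limit d -> ~ determined X d r (below d).
    apply: contrapT => H'; apply: H; exists r => b; apply: contrapT => H''; apply: H'.
    by exists b => d bd ld dd; apply: H''; exists d.
  have [d [h1 h2 h3]] := ka_closure b.
  have [r [rd rP]] := determined_ex cX (conj h1 h2) (fun i h => h).
  exact: (bP r d (h3 _ rd) (conj h1 h2) rP).
pose A0 d := limit d /\ determined X d r (below d).
exists (r, fun d => A0 d /\ exists k, clt k d /\ forall a, A0 a -> clt a d -> cle a k).
split=> [|d [[]]//]; split=> /= [d [[]]//|d|d [Ad [k [kd kP]]]]; last first.
  by exists k; split=> // a [Aa _]; exact: kP.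
have [d' [dd' l' D']] := rP d.
have [a [[da Aa] amin]] := @cle_min ka (fun a => clt d a /\ A0 a) d' (conj dd' (conj l' D')).
exists a; split=> //; split=> //; exists d; split=> // a' Aa' a'a.
by apply/cleNgt => da'; move/cltNge: a'a; apply; apply: amin.
Qed.

Definition coded (Q : point -> point -> Prop) := exists N : Type, ~ (th <~ N) /\
  exists code : point -> N, forall X Y, closed_node X -> closed_node Y -> code X = code Y -> Q X Y.

(** Regularity of [th] puts all the code types below one point. The single type [N] lets [w] itself
    be part of a later code. *)
Lemma coded_family W (Q : W -> point -> point -> Prop) : ~ (th <~ W) ->
  (forall w, coded (Q w)) -> exists N : Type, ~ (th <~ N) /\
  exists code : W -> point -> N, forall w X Y, closed_node X -> closed_node Y -> code w X = code w Y -> Q w X Y.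
Proof.
move=> nW cQ.
have H w : exists p : th * (point -> th), (forall X, clt (p.2 X) p.1) /\
    forall X Y, closed_node X -> closed_node Y -> p.2 X = p.2 Y -> Q w X Y.
  have [N [nN [code cP]]] := cQ w; have [b [j ji]] := proj1 (not_leP _ _) nN.
  exists (b, fun X => sval (j (code X))); split=> [X|X Y cX cY /sub_eq/ji]; last exact: cP.
  exact: (svalP (j (code X))).
have [p pP] := choice H.
have [b bP] := th_reg (fun w => (p w).1) nW.
exists (sub (seg b)); split; first exact: seg_initial.
exists (fun w X => exist _ ((p w).2 X) (clt_trans (proj1 (pP w) X) (bP w))) => w X Y cX cY [].
exact: (proj2 (pP w)).
Qed.

(** Induction on the cofinality of [u]. The value at [n2 u] has fewer than [th] possibilities and
    decides all values outside [rest2]; this exceptional family has smaller cofinality, and the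
    induction hypothesis codes it uniformly over all candidates [w]. *)
Lemma coded_upper (A : set ka) N u : ~ (th <~ N) -> cofam T1 (family A) N -> u `<=` family A ->
  coded (fun X Y => forall e, u e -> X (n1 e) = Y (n1 e)).
Proof.
move=> nN cN; elim/(well_founded_ind (wf_preimage T2 card_wf)): u => u IH uA.
have [nu|eu] := pselect (exists e, u e); last first.
  exists unit; split; last by exists (fun _ => tt) => X Y _ _ _ e ue; case: eu; exists e.
  by apply: mlt_th; apply: (mlt_le _ mlt_ska); exact: unit_le.
have n2u : ~ (th <~ T2 u).
  move=> h; apply: nN; apply: inj_le_trans h _; apply: tau2_min => //; exact: cofam_sub cN.
pose W (w : set (set ka)) := w `<=` u /\ ((exists e, w e) -> ~ (T2 u <~ T2 w)).
have [w|N' [nN' [code cP]]] := @coded_family (set (set ka))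
    (fun w X Y => W w -> forall e, w e -> X (n1 e) = Y (n1 e)) (mlt_th mlt_sska).
  have [[wu ww]|nw] := pselect (W w); last first.
    exists unit; split; last by exists (fun _ => tt) => X Y _ _ _ /nw.
    by apply: mlt_th; apply: (mlt_le _ mlt_ska); exact: unit_le.
  have [nw|ew] := pselect (exists e, w e); last first.
    exists unit; split; last by exists (fun _ => tt) => X Y _ _ _ _ e we; case: ew; exists e.
    by apply: mlt_th; apply: (mlt_le _ mlt_ska); exact: unit_le.
  have [N' [nN' [code cP]]] := IH w (ww nw) (fun e h => uA e (wu e h)).
  by exists N'; split=> //; exists code => X Y cX cY e _; exact: cP.
exists (T2 u * (set (set ka) * N'))%type; split.
  apply: regular_prod => //; apply: regular_prod => //; exact: mlt_th.
exists (fun X => (X (n2 u), (rest2 X u, code (rest2 X u) X))) => X Y cX cY [eu er ec] e ue.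
rewrite -er in ec.
have Wr : W (rest2 X u).
  by split=> [e' []//|nw]; apply: J2_tau => //; exact: rest2_J.
have [h|h] := pselect (rest2 X u e); first exact: (cP _ _ _ cX cY ec Wr).
have h' : ~ rest2 Y u e by rewrite -er.
have -> : X (n1 e) = rep2 (X (n2 u)) (n1 e) by apply: contrapT => n; apply: h.
by rewrite eu; apply: esym; apply: contrapT => n; apply: h'.
Qed.

Lemma below_lev d i : below d i -> c i <~ sub (seg (level d)).
Proof.
by move=> [_ [e [ed h]]]; apply: inj_le_trans h (seg_mono (level_le (cltW ed))).
Qed.

(** Otherwise a closed point is determined on [e0] by its exceptional sets, its pressing-down data,
    and its values on one family and below [r]. These are fewer than [th] codes, and one
    representative for each gives a dominating family on [e0], against [e0_min]. *)
Lemma family_exact_ge : exists A, discrete A /\ forall N, ~ (th <~ N) -> ~ cofam T1 (family A) N.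
Proof.
apply: contrapT => H.
have cA A : discrete A -> coded (fun X Y => forall e, family A e -> X (n1 e) = Y (n1 e)).
  move=> dA; have [N [nN cN]] : exists N, ~ (th <~ N) /\ cofam T1 (family A) N.
    apply: contrapT => H'; apply: H; exists A; split=> // N nN cN; apply: H'; by exists N.
  exact: coded_upper nN cN _.
have [A|NA [nNA [codeA cPA]]] := @coded_family (set ka)
    (fun A X Y => discrete A -> forall e, family A e -> X (n1 e) = Y (n1 e)) (mlt_th mlt_ska).
  have [dA|ndA] := pselect (discrete A).
    by have [N [nN [code cP]]] := cA A dA; exists N; split=> //; exists code => X Y cX cY e _; exact: cP.
  exists unit; split; last by exists (fun _ => tt) => X Y _ _ _ /ndA.
  by apply: mlt_th; apply: (mlt_le _ mlt_ska); exact: unit_le.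
have [r|Nr [nNr [coder cPr]]] := @coded_family ka
    (fun r X Y => forall i, below r i -> X (n0 i) = Y (n0 i)) (mlt_th ka_mu).
  have [code cP] := restriction_code (@below_lev r).
  exists (set (ka * sub (seg (level r)))%type); split.
    by apply/mlt_th/mu_lim/mlt_prod.
  by exists (fun X => code (fun i => X (n0 i))) => X Y _ _ /cP.
have /choice[D DP] (X : point) : exists p : ka * set ka, closed_node X -> discrete p.2 /\
    forall d, p.2 d -> determined X d p.1 (below d).
  have [cX|nX] := pselect (closed_node X); last by have [f _] := ka_inf; exists (f 0, set0).
  by have [p pP] := determined_discrete cX; exists p.
pose N := ((set ka -> set ka) * (ka * (set ka * (Nr * NA))))%type.
have nN : ~ (th <~ N).
  apply: regular_prod => //; first exact/mlt_th/mlt_fun.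
  apply: regular_prod => //; first exact: mlt_th.
  apply: regular_prod => //; first exact: mlt_th.
  exact: regular_prod.
pose code (X : point) : N := (rest1 X, ((D X).1, ((D X).2, (coder (D X).1 X, codeA (D X).2 X)))).
have codeP X Y : closed_node X -> closed_node Y -> code X = code Y -> forall i, e0 i -> X (n0 i) = Y (n0 i).
  move=> cX cY [er e1 e2 e3 e4] i ei; rewrite -e1 in e3; rewrite -e2 in e4.
  have [[dl dunb _] det] := DP X cX.
  have [d' h] := c_lev i; have [d [d'd Ad]] := dunb d'.
  apply: (det d Ad Y cY (esym er)).
  - move=> e' ue'; apply: (cPA _ X Y cX cY e4); first by have [] := DP X cX.
    by exists d.
  - exact: cPr e3.
  - by split=> //; exists d'.
apply: (e0_min nN).
pose rep (n : N) : point := if pselect (exists X, closed_node X /\ code X = n) is left h then projT1 (cid h) else pt0.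
exists (fun n i => rep n (n0 i)) => g.
have [X [cX Xg]] := closed_above (fun v => match v return ncard ka_inf c_reg c_big v with
   inl (inl i) => g i | v => pt0 v end).
exists (code X) => i ei; rewrite /rep; case: pselect => [h|[]]; last by exists X.
have [cY eY] := projT2 (cid h).
by rewrite (codeP _ _ cY cX eY) //; exact: (Xg (n0 i)).
Qed.

Lemma family_sub A e : family A e -> e `<=` e0.
Proof. by move=> [d [_ [h _]]] i /h[]. Qed.

Lemma family_exact_le A : discrete A -> cofam T1 (family A) th.
Proof.
move=> [dl _ _]; have [G Gc] := e0_th.
have /choice[Q QP] (x : th) := tau1_unbounded ka_inf c_reg c_big (G x).
exists Q => q.
have [g gP] := psup c_reg c_big1 (fun e : set ka => scale1 c_reg (q e)) (inj_le_refl _).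
have [x xP] := Gc g; exists x => e fe; apply: cltW.
apply: (proj2 (QP x)) => i; rewrite fillE.
  move=> ei; apply: clt_le_trans (gP e i) (xP i _); exact: (family_sub fe ei).
by have [d [Ad ud]] := fe; exact: (unb_nonempty (dl d Ad) ud).
Qed.

End Localize.

(* [nd d x] codes the values, on the sets [e] below [d], of the [x]-th member of a strongly
   unbounded family in the product of the [tau1 e]; [Ps d] stops at the last isolated level
   before [d], so that for [e] unbounded at the next isolated level there are fewer traces on
   [Ps d] than elements of [tau1 e], and the traces cannot determine the nodes. *)
Lemma branching_tree : exists (nd : ka -> th -> mu) (Ps : ka -> set mu),
  [/\ forall d d' x y, cle d d' -> nd d' x = nd d' y -> nd d x = nd d y,
      forall d d', cle d d' -> Ps d `<=` Ps d',
      forall y, exists d, Ps d y,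
      forall d, exists b, (forall x, clt (nd d x) b) /\ forall y, Ps d y -> clt y b &
      forall (Q : set th) (t : th -> set mu), th <~ sub Q ->
        exists d x y, [/\ Q x, Q y, nd d x <> nd d y & forall z, Ps d z -> (t x z <-> t y z)]].
Proof.
have [c [c_reg c_big c_lev [k SU]]] := strongly_unbounded.
have c_big1 i : ~ (c i <~ set ka).
  move=> h; apply: (c_big i); apply: inj_le_trans h _; exact: inj_le_trans (set_self _) (set_self _).
have [e0 [e0_th e0_min]] := exact_cofinality ka_inf c_reg c_big1 th_reg (mlt_th (mu_lim ka_mu)) SU.
have [A [dA Age]] := family_exact_ge c_reg c_big c_lev e0_min.
have [G Gc] := family_exact_le c_reg c_big e0_th dA.
have [Al Aunb Aisol] := dA.
set T1 := tau1 ka_inf c_big in Age G Gc; set Fm := family c e0 A in Age Gc.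
(* Fewer than [th] functions are never dominating on the family, so [p x] can escape every [G y]
   with [y] before [x]. Hence no function bounds [th] of the [p x]. *)
have /choice[p pP] x : exists q : (forall e, T1 e), forall y, clt y x -> exists e, Fm e /\ clt (G y e) (q e).
  apply: contrapT => H; apply: (Age _ (@seg_initial th x)); exists (fun y => G (sval y)) => q.
  apply: contrapT => H'; apply: H; exists q => y yx; apply: contrapT => H''; apply: H'.
  by exists (exist _ y yx) => e fe; apply/cleNgt => h; apply: H''; exists e.
have SU2 (l : forall e, T1 e) : ~ (th <~ sub (fun x => forall e, Fm e -> cle (p x e) (l e))).
  have [y yP] := Gc l => h; apply: (sub_closed_lt (m := y) th_inf).
  apply: inj_le_trans h _; apply: sub_mono => x xl; apply/cleNgt => /pP[e [fe /cltNge]]; apply.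
  exact: cle_trans (xl e fe) (yP e fe).
pose Dd d : set (set ka) := fun e => Fm e /\ e `<=` below c e0 d.
(* One function for each restriction to [below d] suffices to dominate on [e]. *)
have T1le d e : Dd d e -> T1 e <~ set (ka * sub (seg (level d)))%type.
  move=> [fe ed]; have [code cP] := restriction_code (T := c) (D := below c e0 d) (@below_lev c e0 d).
  have ne : exists i, e i by have [d' [Ad' ud']] := fe; exact: unb_nonempty (Al _ Ad') ud'.
  apply: tau1_min => //.
  have [g0 _] := prod_point ka_inf c_big1.
  exists (fun n => if pselect (exists g, code g = n) is left h then projT1 (cid h) else g0) => g.
  exists (code g) => i ei; case: pselect => [h|[]]; last by exists g.
  by rewrite (proj1 (cP _ _) (projT2 (cid h)) i (ed i ei)); exact: cle_refl.
have /choice[nd ndP] d : exists nd : th -> mu, (exists b, forall x, clt (nd x) b) /\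
    forall x y, nd x = nd y <-> forall e, Dd d e -> p x e = p y e.
  have [code cP] := restriction_code (T1le d).
  have [|b [j ji]] := @mlt_seg_le (set (set ka * set (ka * sub (seg (level d))))%type).
    by apply/mu_lim/mlt_prod; [exact: mu_lim|apply/mu_lim/mlt_prod].
  exists (fun x => sval (j (code (p x)))); split; first by exists b => x; exact: (svalP (j _)).
  by move=> x y; rewrite -cP; split=> [/sub_eq/ji|->].
pose Ps d : set mu := fun y => exists a, [/\ A a, clt a d & clt y (level a)].
exists nd, Ps; split.
- move=> d d' x y dd' /(proj2 (ndP d')) h; apply/(proj2 (ndP d)) => e [fe ed]; apply: h.
  by split=> // i /ed; exact: below_mono.
- by move=> d d' dd' y [a [Aa ad h]]; exists a; split=> //; exact: clt_le_trans ad dd'.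
- move=> y; have [d h] := level_above y; have [a [da Aa]] := Aunb d; have [d' ad'] := ka_next a.
  by exists d', a; split=> //; exact: clt_trans h (level_lt da).
- move=> d; have [[b bP] _] := ndP d; exists (cmax b (level d)); split=> [x|y [a [_ ad ya]]].
    exact: clt_le_trans (bP x) (cmaxl _ _).
  apply: clt_le_trans (cmaxr _ _); exact: clt_trans ya (level_lt ad).
move=> Q t thQ; apply: contrapT => H.
have same d x y : Q x -> Q y -> (forall z, Ps d z -> (t x z <-> t y z)) -> nd d x = nd d y.
  by move=> Qx Qy h; apply: contrapT => n; apply: H; exists d, x, y.
have [q Qq] : exists q, Q q by have [f _] := inj_le_trans th_inf thQ; exists (sval (f 0)); exact: (svalP (f 0)).
(* Without a split, the trace of [x] on the level [kd] decides [p x e]. There are too few such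
   traces for [T1 e], so the values are bounded for every [e], against [SU2]. *)
have bd e : exists b, Fm e -> forall x, Q x -> clt (p x e) b.
  have [fe|nfe] := pselect (Fm e); last by exists (p q e).
  have [d [Ad [ed eunb]]] := fe; have [kd [kdd kP]] := Aisol d Ad.
  (* Two spare levels: [k1] absorbs the power set of the level [kd], and [k2] gives the strict
     inequality in [below]. *)
  have [k1 [kk1 k1d]] := proj2 (Al d Ad) _ kdd; have [k2 [k12 k2d]] := proj2 (Al d Ad) _ k1d.
  pose tr (x : th) : set (sub (seg (level kd))) := fun y => t x (sval y).
  have nT : ~ (T1 e <~ set (sub (seg (level kd)))).
    move=> h; apply: (eunb _ k2d) => i ei; have [e0i _] := ed i ei; split=> //.
    exists k1; split=> //; apply: inj_le_trans (tau1_ge ka_inf c_reg c_big ei) _.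
    exact: inj_le_trans h (level_pow kk1).
  pose z n := if pselect (exists x, Q x /\ tr x = n) is left h then p (projT1 (cid h)) e else p q e.
  have [b bP] := tau1_reg c_reg z nT; exists b => _ x Qx.
  have := bP (tr x); rewrite /z; case: pselect => [h|[]]; last by exists x.
  have [Qx' etr] := projT2 (cid h); set x' := projT1 _ in Qx' etr *.
  suff -> : p x e = p x' e by [].
  apply: (proj1 (proj2 (ndP d) x x')) => //; apply: same => // y [a [Aa ad ya]].
  have yk : clt y (level kd) by apply: clt_le_trans ya (level_le (kP a Aa ad)).
  have : tr x' (exist _ y yk) = tr x (exist _ y yk) by rewrite etr.
  by rewrite /tr /= => ->.
pose l e := projT1 (cid (bd e)).
apply: (SU2 l); apply: inj_le_trans thQ _; apply: sub_mono => x Qx e fe.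
exact/cltW/(projT2 (cid (bd e)) fe x Qx).
Qed.

End Pcf.

(** * Cofinality of [lam] *)

Lemma sub_setT T : sub [set: T] <~ T.
Proof. exact: sub_le. Qed.

Lemma le_sub_setT T : T <~ sub [set: T].
Proof. exact: (@inj_sub _ _ _ id). Qed.

Lemma card_eq_sub T U (A : set T) (B : set U) : A #= B <-> sub A <~ sub B /\ sub B <~ sub A.
Proof.
rewrite -!card_le_sub; split=> [/card_eqPle[]//|h]; exact/card_eqPle.
Qed.

Lemma is_cfP (k c : cardinal) : is_cf k c ->
  (exists z : c -> k, cofin setT z) /\ forall N (z : N -> k), cofin setT z -> c <~ N.
Proof.
move=> [[A cA /card_eq_sub[Ac cA']] cmin]; split.
  have [s sP] := inj_surj (inj_le_trans Ac (sub_setT _)) (inj_le_trans (le_sub_setT _) cA').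
  exists (fun t => sval (s t)); split=> // x _; have [y Ay xy] := cA x.
  by have [t tP] := sP (exist _ y Ay); exists t; rewrite tP.
move=> N z [_ zP].
have [t [h1 h2]] := card_of (sub (range z)).
have ct : c <~ t.
  apply/inj_leP/cmin; exists (range z).
    by move=> x; have [n h] := zP x Logic.I; exists (z n) => //; exists n.
  by apply/card_eq_sub; split; [apply: inj_le_trans h1 (le_sub_setT _)|apply: inj_le_trans (sub_setT _) h2].
apply: inj_le_trans ct (inj_le_trans h2 _).
apply: (@surj_inj _ _ (fun n => exist _ (z n) (ex_intro2 _ _ n Logic.I erefl) : sub (range z))) => -[y [n nn e]].
by exists n; apply: sub_eq.
Qed.

Section Pigeon.
Variables th lam : cardinal.
Hypothesis lam_inf : nat <~ lam.
Hypothesis th_lam : ~ (lam <~ th).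
Hypothesis lam_cof : exists z : th -> lam, cofin setT z.
Hypothesis lam_min : forall N (z : N -> lam), cofin setT z -> th <~ N.

(** [lam] is not assumed regular. If all fibres were small, fewer than [th] bounds on their sizes
    would lie below one [b], and the product of [N] with the segment of [b] is smaller than
    [lam]. *)
Lemma cof_pigeonhole N (F : lam -> N) (Y : set lam) : ~ (th <~ N) -> lam <~ sub Y ->
  exists n, lam <~ sub (fun b => Y b /\ F b = n).
Proof.
move=> nN [e ei]; pose G b := F (sval (e b)).
suff [n h] : exists n, lam <~ sub (fun b => G b = n).
  exists n; apply: inj_le_trans h _; apply: (@inj_sub _ _ _ (fun b => sval (e (sval b)))).
    by move=> b b' /sub_eq/ei/sub_eq.
  by move=> b; split; [exact: (svalP (e _))|exact: (svalP b)].
apply: contrapT => H.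
have /choice[x xP] n : exists x : lam, sub (fun b => G b = n) <~ sub (seg x).
  by apply/not_leP => h; apply: H; exists n.
have [b [_ bP]] := cofin_bound (X := setT) lam_min nN (fun n => Logic.I : setT (x n)).
have : lam <~ (N * sub (seg b))%type.
  apply: inj_le_trans (_ : {n & sub (fun b => G b = n)} <~ _); last first.
    apply: sigT_le => n; apply: inj_le_trans (xP n) _; apply: sub_mono => y yx.
    exact: clt_trans yx (bP n).
  by exists (fun b => existT _ (G b) (exist _ b erefl)) => y y' [].
apply: prod_lt => //; last exact: seg_initial.
by move=> h; apply: nN; exact: inj_le_trans (not_inj_le th_lam) h.
Qed.

Lemma cof_index : exists i : lam -> th, forall t, ~ (lam <~ sub (fun b => i b = t)).
Proof.
have [z [_ zP]] := lam_cof; have [i iP] := choice (fun b => zP b Logic.I).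
exists i => t h; apply: (sub_closed_lt (m := z t) lam_inf); apply: inj_le_trans h _.
by apply: sub_mono => b <-.
Qed.

End Pigeon.

(** * Fields of sets as Boolean algebras *)

Record set_field T := SetField {
  field_sets : set (set T);
  field0 : field_sets set0;
  fieldI : forall A B, field_sets A -> field_sets B -> field_sets (A `&` B);
  fieldC : forall A, field_sets A -> field_sets (~` A)
}.

Definition fset_of T (F : set_field T) : Type := sub (field_sets F).

Section FieldAlgebra.
Variables (T : Type) (F : set_field T).
Implicit Types a b c : fset_of F.

HB.instance Definition _ := gen_eqMixin (fset_of F).
HB.instance Definition _ := gen_choiceMixin (fset_of F).

Definition fval a : set T := sval a.

Lemma fval_inj : injective fval.
Proof. by move=> a b; exact: sub_eq. Qed.

Lemma fieldU A B : field_sets F A -> field_sets F B -> field_sets F (A `|` B).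
Proof. by move=> /fieldC hA /fieldC hB; rewrite -(setCK (A `|` B)) setCU; exact/fieldC/fieldI. Qed.

Definition fmeet a b : fset_of F := exist _ (fval a `&` fval b) (fieldI (svalP a) (svalP b)).
Definition fjoin a b : fset_of F := exist _ (fval a `|` fval b) (fieldU (svalP a) (svalP b)).
Definition fcompl a : fset_of F := exist _ (~` fval a) (fieldC (svalP a)).
Definition fbot : fset_of F := exist _ set0 (field0 F).

Lemma fle_def a b : `[< fval a `<=` fval b >] = (fmeet a b == a).
Proof.
apply/asboolP/eqP => [h|/(congr1 fval) /= h]; last exact/setIidPl.
by apply: fval_inj; exact/setIidPl.
Qed.

Lemma flt_def a b : (b != a) && `[< fval a `<=` fval b >] = (b != a) && `[< fval a `<=` fval b >].
Proof. by []. Qed.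

Let fmeetC : commutative fmeet. Proof. by move=> a b; apply: fval_inj; exact: setIC. Qed.
Let fjoinC : commutative fjoin. Proof. by move=> a b; apply: fval_inj; exact: setUC. Qed.
Let fmeetA : associative fmeet. Proof. by move=> a b c; apply: fval_inj; exact: setIA. Qed.
Let fjoinA : associative fjoin. Proof. by move=> a b c; apply: fval_inj; exact: setUA. Qed.
Let fjoinKI b a : fmeet a (fjoin a b) = a.
Proof. by apply: fval_inj; rewrite /= setUC setKU. Qed.
Let fmeetKU b a : fjoin a (fmeet a b) = a.
Proof. by apply: fval_inj; rewrite /= setIC setKI. Qed.
Let fmeetUl : left_distributive fmeet fjoin.
Proof. by move=> a b c; apply: fval_inj; exact: setIUl. Qed.
Let fmeetxx : idempotent_op fmeet.
Proof. by move=> a; apply: fval_inj; exact: setIid. Qed.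

HB.instance Definition _ := Order.isMeetJoinDistrLattice.Build set_display (fset_of F)
  fle_def flt_def fmeetC fjoinC fmeetA fjoinA fjoinKI fmeetKU fmeetUl fmeetxx.

Lemma fle0 a : (fbot <= a)%O.
Proof. by apply/asboolP => x []. Qed.
Lemma fle1 a : (a <= fcompl fbot)%O.
Proof. by apply/asboolP => x _ []. Qed.

HB.instance Definition _ := Order.hasBottom.Build set_display (fset_of F) fle0.
HB.instance Definition _ := Order.hasTop.Build set_display (fset_of F) fle1.

Definition fdiff a b := fmeet a (fcompl b).

Lemma fdiffKI a b : Order.meet b (fdiff a b) = Order.bottom.
Proof. by apply: fval_inj; rewrite /= setICA setICr setI0. Qed.
Lemma fjoinIB a b : Order.join (Order.meet a b) (fdiff a b) = a.
Proof. by apply: fval_inj; rewrite /= -setIUr setUCr setIT. Qed.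

HB.instance Definition _ := Order.BDistrLattice_hasSectionalComplement.Build
  set_display (fset_of F) fdiffKI fjoinIB.

Lemma fcomplE a : fcompl a = Order.diff (Order.top : fset_of F) a.
Proof. by apply: fval_inj; rewrite /= setC0 setTI. Qed.

HB.instance Definition _ := Order.CBDistrLattice_hasComplement.Build
  set_display (fset_of F) fcomplE.

End FieldAlgebra.

Lemma field_representation T (F : set_field T) :
  exists (d : Order.disp_t) (B : ctbDistrLatticeType d) (v : B -> set T),
  [/\ injective v, forall A, field_sets F A <-> exists b, v b = A,
      forall a b, (a <= b)%O <-> v a `<=` v b,
      forall a b, v (Order.join a b) = v a `|` v b & v Order.bottom = set0].
Proof.
exists set_display, (fset_of F : ctbDistrLatticeType _), (@fval T F); split=> //.
- exact: fval_inj.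
- by move=> A; split=> [h|[b <-]]; [exists (exist _ A h)|exact: (svalP b)].
- by move=> a b; split=> /asboolP.
Qed.

(** * The algebra of the tree *)

Lemma ex_choice T U (P : T -> U -> Prop) : (forall t, exists u, P t u) ->
  exists f : T -> U, forall t, P t (f t).
Proof. by move=> /choice[f fP]; exists f. Qed.

Section TreeAlgebra.
Variables mu ka th lam : cardinal.
Hypothesis mu_inf : nat <~ mu.
Hypothesis mu_lim : forall T, ~ (mu <~ T) -> ~ (mu <~ set T).
Hypothesis ka_mu : ka <~ mu.
Hypothesis ka_pt : exists d : ka, True.
Hypothesis th_mu : ~ (th <~ mu).
Hypothesis th_lam : ~ (lam <~ th).
Hypothesis lam_min : forall N (z : N -> lam), cofin setT z -> th <~ N.
Variables (nd : ka -> th -> mu) (Ps : ka -> set mu) (D : lam -> set mu) (i : lam -> th).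
Hypothesis D_inj : injective D.
Hypothesis i_small : forall t, ~ (lam <~ sub (fun b => i b = t)).
Hypothesis nd_mono : forall d d' x y, cle d d' -> nd d' x = nd d' y -> nd d x = nd d y.
Hypothesis Ps_mono : forall d d', cle d d' -> Ps d `<=` Ps d'.
Hypothesis Ps_cover : forall y, exists d, Ps d y.
Hypothesis bounded : forall d, exists b, (forall x, clt (nd d x) b) /\ forall y, Ps d y -> clt y b.
Hypothesis split_nd : forall (Q : set th) (t : th -> set mu), th <~ sub Q ->
  exists d x y, [/\ Q x, Q y, nd d x <> nd d y & forall z, Ps d z -> (t x z <-> t y z)].

Let mu_th : mu <~ th. Proof. exact: not_inj_le. Qed.
Let th_le_lam : th <~ lam. Proof. exact: not_inj_le. Qed.
Let mu_lam : mu <~ lam. Proof. exact: inj_le_trans mu_th th_le_lam. Qed.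
Let lam_inf : nat <~ lam. Proof. exact: inj_le_trans mu_inf mu_lam. Qed.
Let lam_mu : ~ (lam <~ mu). Proof. by move=> h; apply: th_lam; exact: inj_le_trans h mu_th. Qed.
Let le_mu_th T : T <~ mu -> ~ (th <~ T).
Proof. by move=> h h'; apply: th_mu; exact: inj_le_trans h' h. Qed.

Definition big (Y : set lam) := lam <~ sub Y.

Let pigeonhole N (F : lam -> N) Y : ~ (th <~ N) -> big Y -> exists n, big (fun b => Y b /\ F b = n).
Proof. exact: (cof_pigeonhole lam_inf th_lam lam_min). Qed.

Definition nod (d : ka) (a : lam) : mu := nd d (i a).
Definition agree (d : ka) (a b : lam) := forall y, Ps d y -> (D a y <-> D b y).
Definition equiv (a b : lam) := forall d, nod d a = nod d b.

Lemma nod_le d d' a b : cle d d' -> nod d' a = nod d' b -> nod d a = nod d b.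
Proof. exact: nd_mono. Qed.

Lemma agree_le d d' a b : cle d d' -> agree d' a b -> agree d a b.
Proof. by move=> /Ps_mono h g y /h/g. Qed.

Lemma agree_sym d a b : agree d a b -> agree d b a.
Proof. by move=> h y /h[]. Qed.

Lemma agree_trans d a b c : agree d a b -> agree d b c -> agree d a c.
Proof. by move=> h h' y dy; rewrite (h y dy) (h' y dy). Qed.

Lemma agree_neq a b : a <> b -> exists d, ~ agree d a b.
Proof.
move=> ab; apply: contrapT => H; apply: ab; apply: D_inj; apply/funext => y; apply/propext.
by have [d dy] := Ps_cover y; apply: contrapT => n; apply: H; exists d => /(_ y dy).
Qed.

Definition split_at (d : ka) (a b : lam) :=
  (forall d', clt d' d -> nod d' a = nod d' b) /\ nod d a <> nod d b.

Lemma split_atP d a b : nod d a <> nod d b -> exists2 d', cle d' d & split_at d' a b.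
Proof.
move=> n; have [m [mn mmin]] := @cle_min ka (fun d => nod d a <> nod d b) d n.
exists m; first exact: mmin.
split=> // d' d'm; apply: contrapT => n'; move/cltNge: d'm; apply; exact: mmin.
Qed.

Lemma split_at_unique d d' a b : split_at d a b -> split_at d' a b -> d = d'.
Proof.
move=> [h n] [h' n']; case: (clt_or d d') => // l; [by case: n; exact: h'|by case: n'; exact: h].
Qed.

Definition gen (a b : lam) := b = a \/
  exists d, [/\ split_at d a b, clt (nod d a) (nod d b) & agree d a b].

Lemma gen_split d a b : split_at d a b -> gen a b <-> clt (nod d a) (nod d b) /\ agree d a b.
Proof.
move=> s; split=> [[e|[d' [s' h1 h2]]]|[h1 h2]]; last by right; exists d.
  by case: s => _; rewrite e.
by rewrite (split_at_unique s s').
Qed.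

Lemma gen_equiv a b : equiv a b -> gen a b -> b = a.
Proof. by move=> e [//|[d [[_ n]]]]; case: n; exact: e. Qed.

(** The split of [a] from [b] happens no later than [d], and up to there [b'] has the same nodes as
    [b] and an agreeing trace. *)
Lemma gen_level d a b b' : nod d b <> nod d a -> nod d b = nod d b' -> agree d b b' ->
  gen a b -> gen a b'.
Proof.
move=> n e ag.
have /split_atP[d' d'd s] : nod d a <> nod d b by move=> h; apply: n.
have s' : split_at d' a b'.
  case: s => h1 h2; split=> [d'' h|]; first by rewrite h1 //; apply: nod_le e; exact: cle_trans (cltW h) d'd.
  by rewrite -(nod_le d'd e).
move=> /(gen_split s)[h1 h2]; apply/(gen_split s'); rewrite -(nod_le d'd e); split=> //.
exact: agree_trans h2 (agree_le d'd ag).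
Qed.

Lemma gen_level_iff d a b b' : nod d b <> nod d a -> nod d b = nod d b' -> agree d b b' ->
  gen a b <-> gen a b'.
Proof.
move=> n e ag; split; first exact: gen_level ag.
by apply: (gen_level (d := d)); [rewrite -e|rewrite e|exact: agree_sym].
Qed.

Lemma gen_inj : injective gen.
Proof.
move=> a b e; apply: contrapT => n.
have ab : gen a b by rewrite e; left.
have ba : gen b a by rewrite -e; left.
case: ab => [/esym//|[d [[h1 h2] h3 _]]]; case: ba => [//|[d' [[h1' h2'] h3' _]]].
have ed : d = d'.
  by apply: (@split_at_unique _ _ a b); split=> //; [move=> q /h1' ->|move=> h; apply: h2'].
by rewrite -ed in h3'; apply: (clt_irr (clt_trans h3 h3')).
Qed.

(* [{classic lam}] has the decidable equality that membership in a sequence requires. *)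
Local Notation lseq := (seq {classic lam}).
Definition below_agree (y : mu) (a b : lam) := forall z, clt z y -> (D a z <-> D b z).

(** In this form closure under Boolean operations is immediate and no terms are needed: a level, a
    bounded trace and finitely many generators decide membership. *)
Definition supported (d : ka) (y : mu) (s : lseq) (A : set lam) := forall b b',
  nod d b = nod d b' -> below_agree y b b' ->
  (forall a, a \in s -> (gen a b <-> gen a b')) -> A b -> A b'.
Definition algebra (A : set lam) := exists d y s, supported d y s A.
Definition level_set (A : set lam) := exists d y, supported d y [::] A.

Lemma below_agree_sym y a b : below_agree y a b -> below_agree y b a.
Proof. by move=> h z /h[]. Qed.
Lemma below_agree_trans y a b c : below_agree y a b -> below_agree y b c -> below_agree y a c.
Proof. by move=> h h' z zy; rewrite (h z zy) (h' z zy). Qed.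
Lemma below_agree_le y y' a b : cle y y' -> below_agree y' a b -> below_agree y a b.
Proof. by move=> yy h z zy; apply: h; exact: clt_le_trans zy yy. Qed.

Lemma supported_le d d' y y' s s' A : cle d d' -> cle y y' -> {subset s <= s'} ->
  supported d y s A -> supported d' y' s' A.
Proof.
move=> dd yy ss H b b' e ag h; apply: H; [exact: nod_le e|exact: below_agree_le ag|by move=> a /ss/h].
Qed.

Lemma supportedI d y s A B : supported d y s A -> supported d y s B -> supported d y s (A `&` B).
Proof. by move=> hA hB b b' e ag h [/(hA _ _ e ag h) ? /(hB _ _ e ag h)]. Qed.

Lemma supportedC d y s A : supported d y s A -> supported d y s (~` A).
Proof.
move=> H b b' e ag h nA /(H b' b (esym e) (below_agree_sym ag)) Ab; apply: nA; apply: Ab => a /h.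
by case.
Qed.

Lemma algebraI A B : algebra A -> algebra B -> algebra (A `&` B).
Proof.
move=> [d [y [s h]]] [d' [y' [s' h']]]; exists (cmax d d'), (cmax y y'), (s ++ s').
apply: supportedI; [apply: supported_le h|apply: supported_le h'];
  rewrite ?cmaxl ?cmaxr //= => a; by rewrite mem_cat => ->; rewrite ?orbT.
Qed.

Lemma algebraC A : algebra A -> algebra (~` A).
Proof. by move=> [d [y [s h]]]; exists d, y, s; exact: supportedC. Qed.

Let mu_pt : exists y : mu, True.
Proof. by have [f _] := mu_inf; exists (f 0). Qed.

Lemma algebra_gen a : algebra (gen a).
Proof.
have [d _] := ka_pt; have [y _] := mu_pt.
by exists d, y, [:: (a : {classic lam})] => b b' _ _ h; apply: (proj1 (h a _)); rewrite inE.
Qed.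

Lemma level_set_algebra A : level_set A -> algebra A.
Proof. by move=> [d [y h]]; exists d, y, [::]. Qed.

(** A supported set is a union of cells given by a node, a trace below [y] and a subset of the
    finite [s]. There are fewer than [mu] cells, so the unions have codes in [mu]. *)
Lemma supported_code d y s : exists E : set lam -> mu, forall A B,
  supported d y s A -> supported d y s B -> E A = E B -> A = B.
Proof.
have [b [bP _]] := bounded d.
pose P := (sub (seg b) * (set (sub (seg y)) * set (sub (fun a : {classic lam} => a \in s))))%type.
have sP : ~ (mu <~ sub (fun a : {classic lam} => a \in s)).
  by move=> /(inj_le_trans mu_inf); apply: inj_finite; exact: finite_seq.
have [E Ei] : set P <~ mu.
  apply/not_inj_le/mu_lim/prod_lt => //; first exact: seg_initial.
  by apply: prod_lt => //; apply: mu_lim => //; exact: seg_initial.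
pose cell (a : lam) : P := (exist _ (nod d a) (bP (i a)),
  ((fun z => D a (sval z)), (fun c => gen (sval c) a))).
pose im A : set P := fun p => exists2 a, A a & cell a = p.
exists (fun A => E (im A)).
suff H A B : supported d y s B -> E (im A) = E (im B) -> A `<=` B.
  by move=> A B hA hB e; apply/seteqP; split; [exact: H e|apply: H (esym e)].
move=> hB /Ei e a Aa.
have : im A (cell a) by exists a.
rewrite e => -[a' Ba' [e1 e2 e3]]; apply: (hB a') => // [z zy|c cs].
  by have := congr1 (fun f => f (exist _ z zy)) e2 => /= ->.
by have := congr1 (fun f => f (exist _ c cs)) e3 => /= ->.
Qed.

Lemma algebra_le : sub algebra <~ lam.
Proof.
have nl : nat <~ lam := lam_inf.
apply: (@inj_le_trans (ka * mu * lseq * mu)%type); last first.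
  apply: inj_le_prod => //; apply: inj_le_prod => //; last by apply: seq_le => //; exact: inj_le_refl.
  by apply: inj_le_prod => //; exact: inj_le_trans ka_mu mu_lam.
apply: (@rel_inj _ _ (fun A p => supported p.1.1.1 p.1.1.2 p.1.2 (sval A) /\
   projT1 (cid (supported_code p.1.1.1 p.1.1.2 p.1.2)) (sval A) = p.2)).
  by move=> [A [d [y [s h]]]]; exists (d, y, s, projT1 (cid (supported_code d y s)) A).
move=> A B [[[d y] s] m] /= [hA eA] [hB eB]; apply: sub_eq.
by apply: (projT2 (cid (supported_code d y s))) => //; exact: etrans eA (esym eB).
Qed.

Lemma le_algebra : lam <~ sub algebra.
Proof. exact: (inj_sub gen_inj algebra_gen). Qed.

Lemma level_code : exists E : set lam -> mu, forall A B, level_set A -> level_set B -> E A = E B -> A = B.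
Proof.
have : sub level_set <~ mu.
  apply: (@inj_le_trans (ka * mu * mu)%type); last first.
    by apply: inj_le_prod => //; [apply: inj_le_prod => //|]; exact: inj_le_refl.
  apply: (@rel_inj _ _ (fun A p => supported p.1.1 p.1.2 [::] (sval A) /\
     projT1 (cid (supported_code p.1.1 p.1.2 [::])) (sval A) = p.2)).
    by move=> [A [d [y h]]]; exists (d, y, projT1 (cid (supported_code d y [::])) A).
  move=> A B [[d y] m] /= [hA eA] [hB eB]; apply: sub_eq.
  by apply: (projT2 (cid (supported_code d y [::]))) => //; exact: etrans eA (esym eB).
move=> [E Ei]; have [m _] := mu_pt.
exists (fun A => if pselect (level_set A) is left h then E (exist _ A h) else m) => A B hA hB.
by case: pselect => // hA'; case: pselect => // hB' /Ei [].
Qed.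

(** The class has a single branch, so by [split_nd] fewer than [th] values of [i] occur in it. Each
    of them is taken by fewer than [lam] indices, and the pigeonhole principle applies. *)
Lemma class_small (t : th) : ~ big (fun b => forall d, nod d b = nd d t).
Proof.
pose Q (u : th) := forall d, nd d u = nd d t.
have nQ : ~ (th <~ sub Q).
  move=> /(split_nd (fun _ => set0))[d [x [y [Qx Qy n _]]]]; apply: n.
  by rewrite (Qx d) (Qy d).
have Qt : Q t by [].
move=> /(pigeonhole (fun b => if pselect (Q (i b)) is left h then exist _ (i b) h else exist Q t Qt) nQ).
move=> [[u Qu] h]; apply: (i_small (t := u)); apply: inj_le_trans h _; apply: sub_mono => b [Qb].
by case: pselect => [h' []|].
Qed.

Lemma class_large eta : ~ (lam <~ eta) -> exists t, ~ (sub (fun b => forall d, nod d b = nd d t) <~ eta).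
Proof.
move=> ne; apply: contrapT => H.
apply: (@prod_lt lam th eta) => //.
apply: inj_le_trans (_ : {t & sub (fun b => forall d, nod d b = nd d t)} <~ _); last first.
  by apply: sigT_le => t; apply: contrapT => n; apply: H; exists t.
by exists (fun b => existT (fun t => sub (fun b => forall d, nod d b = nd d t)) (i b)
  (exist _ b (fun d => erefl))) => b b' /(congr1 (fun p => sval (projT2 p))).
Qed.

Definition ideal_of_sets (J : set (set lam)) := [/\ J set0,
  forall A B, A `<=` B -> J B -> J A & forall A B, J A -> J B -> J (A `|` B)].

Lemma ideal_finite_union J (s : lseq) (F : lam -> set lam) : ideal_of_sets J ->
  (forall a, a \in s -> J (F a)) -> J (fun b => exists2 a, a \in s & F a b).
Proof.
move=> [J0 Js JU]; elim: s => [|c s IH] h; first by apply: Js J0 => b [].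
apply: Js (JU _ _ (h c (mem_head _ _)) (IH (fun a as_ => h a (mem_behead (s := c :: s) as_)))).
by move=> b [a]; rewrite inE => /orP[/eqP ->|as_] Fb; [left|right; exists a].
Qed.

Lemma seq_bound (s : lseq) (f : lam -> ka) d : exists e, cle d e /\ forall a, a \in s -> cle (f a) e.
Proof.
elim: s => [|c s [e [de IH]]]; first by exists d; split=> //; exact: cle_refl.
exists (cmax (f c) e); split; first exact: cle_trans de (cmaxr _ _).
move=> a; rewrite inE => /orP[/eqP ->|/IH h]; first exact: cmaxl.
exact: cle_trans h (cmaxr _ _).
Qed.

Lemma separating_level (s : lseq) d : exists e, cle d e /\ forall a a', a \in s -> a' \in s ->
  (~ equiv a a' -> nod e a <> nod e a') /\ (a <> a' -> ~ agree e a a').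
Proof.
have h (a a' : lam) : exists d, (~ equiv a a' -> nod d a <> nod d a') /\ (a <> a' -> ~ agree d a a').
  have [d1 h1] : exists d, ~ equiv a a' -> nod d a <> nod d a'.
    have [e|ne] := pselect (equiv a a'); first by exists d => /(_ e).
    by apply: contrapT => H; apply: ne => d'; apply: contrapT => n; apply: H; exists d'.
  have [d2 h2] : exists d, a <> a' -> ~ agree d a a'.
    by have [->|/agree_neq[d2 h2]] := pselect (a = a'); [exists d|exists d2].
  exists (cmax d1 d2); split=> [ne /(nod_le (cmaxl _ _))|n /(agree_le (cmaxr _ _))]; [exact: h1|exact: h2].
pose g a := projT1 (choice (h a)); have gP a := projT2 (choice (h a)).
have [g1 g1P] := choice (fun a => seq_bound s (g a) d).
have [e [de eP]] := seq_bound s g1 d; exists e; split=> // a a' as_ as'.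
have l : cle (g a a') e by apply: cle_trans (eP a as_); exact: (proj2 (g1P a)).
have [p1 p2] := gP a a'; rewrite -/(g a) in p1 p2.
by split=> [/p1 h' /(nod_le l)|/p2 h' /(agree_le l)].
Qed.

Definition vee (k : bool) (t : lseq) : set lam :=
  fun b => forall a, a \in t -> if k then gen a b else ~ gen a b.

Lemma vee_level d (a : lam) k (t : lseq) b b' : (forall c, c \in t -> equiv c a) ->
  nod d b <> nod d a -> nod d b = nod d b' -> agree d b b' -> vee k t b -> vee k t b'.
Proof.
move=> ta n e ag v c ct; have := v c ct.
have nc : nod d b <> nod d c by rewrite (ta c ct d).
by case: k {v}; rewrite (gen_level_iff nc e ag).
Qed.

(** The side of [b] for which a piece of sign [k] following [a] falls into [vee k] of [b]: [b] is
    left of [a] for generators and right of [a] for complements. *)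
Definition oriented (k : bool) d a b :=
  if k then clt (nod d b) (nod d a) else clt (nod d a) (nod d b).

(** As [b] follows [a] up to [d], it leaves [a'] at [d0] on the same side as [a]. For [k] true it
    must also agree with [a'] at [d0], which is known only through [a]; hence the single generator
    in [t']. *)
Lemma vee_cross (k : bool) d d0 (a a' : lam) (t t' : lseq) b :
  (a : {classic lam}) \in t -> (forall c, c \in t' -> equiv c a') -> (k -> t' = [:: a' : {classic lam}]) ->
  agree d a a' -> cle d0 d -> split_at d0 a a' -> oriented k d0 a a' ->
  nod d b = nod d a -> vee k t b -> vee k t' b.
Proof.
move=> at_ ta' tk ag d0d [s1 s2] o nb v c ct.
have nb0 d' : cle d' d0 -> nod d' b = nod d' a by move=> h; apply: nod_le nb; exact: cle_trans h d0d.
have s : split_at d0 c b.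
  split=> [d' h|]; first by rewrite (ta' c ct d') (nb0 d' (cltW h)) (s1 d' h).
  by rewrite (ta' c ct d0) (nb0 d0 (cle_refl d0)); exact: nesym.
case: k o tk v => /= [o tk v|o _ v].
  apply/(gen_split s); rewrite (ta' c ct d0) (nb0 d0 (cle_refl d0)); split=> //.
  have -> : c = a' by move: ct; rewrite (tk isT) inE => /eqP.
  apply: (agree_trans (agree_sym (agree_le d0d ag))).
  (* A split of [b] from [a] can only come after [d], so membership in [gen a] gives agreement at
     [d0]. *)
  case: (v a at_) => [->//|[d' [[h1 h2] _ h3]]]; apply: agree_le h3; apply: cle_trans d0d _.
  by case: (cle_or_lt d d') => // /cltW/nod_le h; case: h2; apply: esym; exact: h nb.
move=> /(gen_split s)[]; rewrite (ta' c ct d0) (nb0 d0 (cle_refl d0)) => h _.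
exact: clt_irr (clt_trans h o).
Qed.

(* [q] is determined by a level and a bounded trace, so there are at most [mu] of them; apart
   from that, a piece only depends on the sequence [t] of pairwise equivalent indices. *)
Definition piece (A : set lam) (J : set (set lam)) (p : bool * set lam * ka * lam * lseq) :=
  let: (k, q, d, a, t) := p in
  [/\ level_set q, forall b, q b -> nod d b = nod d a,
      (a : {classic lam}) \in t /\ (forall c, c \in t -> equiv c a),
      k -> t = [:: a : {classic lam}] & q `&` vee k t `<=` A /\ ~ J (q `&` vee k t)].

(** At a level separating [s], node and trace of a point that follows [a] decide its membership in
    all generators not equivalent to [a]. [P0] follows no member of [s] and is a level set; [P1 a]
    and [P2 a] are level sets cut by one generator, respectively by complements. Finitely many of
    these cover [A], so one is outside [J]. *)
Lemma piece_ex A J : ideal_of_sets J -> algebra A -> ~ J A ->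
  (exists P, [/\ level_set P, P `<=` A & ~ J P]) \/ exists p, piece A J p.
Proof.
move=> iJ [d0 [y0 [s supA]]] nJ; have [_ Js JU] := iJ.
have [d [d0d sep]] := separating_level s d0.
have [y1 [_ y1P]] := bounded d; pose y := cmax y0 y1.
have ag_y b b' : below_agree y b b' -> agree d b b'.
  by move=> h z /y1P zy; apply: h; exact: clt_le_trans zy (cmaxr _ _).
have supp (a : lam) b b' : nod d b = nod d a -> nod d b' = nod d a -> a \in (s : lseq) ->
    below_agree y b b' -> (forall c, c \in s -> equiv c a -> (gen c b <-> gen c b')) -> A b -> A b'.
  move=> e e' as_ ag h; apply: supA; first by apply: (nod_le d0d); rewrite e e'.
    by apply: below_agree_le ag; exact: cmaxl.
  move=> c cs; have [|n] := pselect (equiv c a); first exact: h.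
  by apply: (gen_level_iff (d := d)); [rewrite e => /esym; apply: (proj1 (sep c a cs as_))|rewrite e|exact: ag_y].
pose P0 b := A b /\ forall a, a \in s -> nod d b <> nod d a.
pose P1 a b := [/\ A b, nod d b = nod d a & gen a b].
pose P2 a b := [/\ A b, nod d b = nod d a & forall c, c \in s -> equiv c a -> ~ gen c b].
pose q (P : lam -> set lam) a : set lam := fun b => nod d b = nod d a /\ exists2 b', P a b' & below_agree y b' b.
have q_level P a : level_set (q P a).
  exists d, y => b b' e ag _ [h1 [b'' h2 h3]]; split; first by rewrite -e.
  by exists b'' => //; exact: below_agree_trans h3 ag.
apply: contrapT => H.
have J0 : J P0.
  apply: contrapT => n; apply: H; left; exists P0; split=> //; last by move=> b [].
  exists d, y => b b' e ag _ [h1 h2]; split; last by move=> a /h2; rewrite e.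
  apply: (supA b) => //; [exact: (nod_le d0d)|by apply: below_agree_le ag; exact: cmaxl|].
  by move=> a /h2 h; apply: (gen_level_iff (d := d)) => //; exact: ag_y.
have J1 a : a \in s -> J (P1 a).
  move=> as_; apply: contrapT => n; apply: H; right.
  exists (true, q P1 a, d, a, [:: a : {classic lam}]); split=> //.
  - by move=> b [].
  - by split=> [|c]; rewrite inE // => /eqP ->.
  split=> [b [[e [b' [Ab' e' g'] ag]] v]|h].
    have g : gen a b by apply: (v a); rewrite inE.
    apply: (supp a b') => // c cs ce.
    have [->//|ca] := pselect (c = a).
    (* Two distinct equivalent generators share no point that follows them to [d]: it would agree
       with both on [Ps d], where distinct members of [s] differ. *)
    have nogen x : nod d x = nod d a -> gen a x -> ~ gen c x.
      move=> ex ga gc; have [ex'|nx] := pselect (equiv a x).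
        by move: gc; rewrite (gen_equiv ex' ga) => /(gen_equiv ce) /esym.
      case: ga => [xa|[d' [s1 _ ag1]]]; first by apply: nx => d'; rewrite xa.
      have s1' : split_at d' c x by case: s1 => h1 h2; split=> [d'' /h1|]; rewrite (ce _).
      have [_ ag2] := proj1 (gen_split s1') gc.
      have dd' : cle d d'.
        by case: (cle_or_lt d d') => // /cltW/nod_le h; case: s1 => _ []; apply: esym; exact: h ex.
      apply: (proj2 (sep c a cs as_) ca); apply: agree_le dd' _.
      exact: agree_trans ag2 (agree_sym ag1).
    by split=> h; [case: (nogen b')|case: (nogen b)].
  apply: n; apply: Js h => b [Ab e g]; split.
    by split=> //; exists b => // z.
  by move=> c; rewrite inE => /eqP ->.
have J2 a : a \in s -> J (P2 a).
  move=> as_; apply: contrapT => n; apply: H; right.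
  pose t : lseq := [seq c <- s | `[< equiv c a >]].
  have tP c : c \in t <-> c \in s /\ equiv c a.
    by rewrite mem_filter; split=> [/andP[/asboolP]|[h1 h2]] //; apply/andP; split=> //; apply/asboolP.
  exists (false, q P2 a, d, a, t); split=> //.
  - by move=> b [].
  - by split=> [|c /tP[]//]; apply/tP; split.
  split=> [b [[e [b' [Ab' e' g'] ag]] v]|h].
    apply: (supp a b') => // c cs ce; split=> h; first by case: (g' c).
    by case: (v c) => //; apply/tP.
  apply: n; apply: Js h => b [Ab e g]; split; last by move=> c /tP[cs ce]; exact: g.
  by split=> //; exists b => // z.
apply: nJ; apply: Js (JU _ _ J0 (JU _ _ (ideal_finite_union iJ J1) (ideal_finite_union iJ J2))) => b Ab.
have [[a [as_ e]]|n] := pselect (exists a, a \in s /\ nod d b = nod d a); last first.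
  by left; split=> // a as_ e; apply: n; exists a.
right; have [[c [cs ce g]]|n] := pselect (exists c, [/\ c \in s, equiv c a & gen c b]).
  by left; exists c => //; split=> //; rewrite e (ce d).
by right; exists a => //; split=> // c cs ce g; apply: n; exists c.
Qed.

(** * Absence of free sequences of length lam *)

Section NoFree.
Variables (R : lam -> lam -> Prop) (J : lam -> set (set lam)) (a : lam -> set lam).
Hypothesis R_or : forall z x, z <> x -> R z x \/ R x z.
Hypothesis R_big : forall Y1 Y2, big Y1 -> big Y2 -> exists z x, [/\ Y1 z, Y2 x & R z x].
Hypothesis J_ideal : forall z, ideal_of_sets (J z).
Hypothesis a_algebra : forall z, algebra (a z).
Hypothesis J_mem : forall z x, R z x -> J z (a x).
Hypothesis J_not : forall z, ~ J z (a z).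

Let J_sub z A B : A `<=` B -> J z B -> J z A.
Proof. by have [_ h _] := J_ideal z; exact: h. Qed.

Let share z x P : z <> x -> P `<=` a z -> P `<=` a x -> ~ J z P -> J x P.
Proof.
move=> /R_or[/J_mem h|/J_mem h] Pz Px n; last exact: J_sub Pz h.
by case: n; exact: J_sub Px h.
Qed.

Let leveled z := exists P, [/\ level_set P, P `<=` a z & ~ J z P].

Let big_two Y : big Y -> exists z x, [/\ Y z, Y x & z <> x].
Proof.
move=> [e ei]; have [f fi] := lam_inf.
exists (sval (e (f 0))), (sval (e (f 1))); split; [exact: (svalP (e _))|exact: (svalP (e _))|].
by move=> /sub_eq/ei/fi.
Qed.

(** [R] covers the three notions of freeness at once: distinct indices are related in some
    direction, and [R_big] provides a prescribed direction inside large sets. *)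
Lemma no_free : False.
Proof.
have [E Ei] := level_code.
have bool_le : bool <~ mu.
  by apply: inj_le_trans mu_inf; exists (fun b : bool => nat_of_bool b) => -[] [].
(* There are at most [mu] level sets, so two members would share one outside their ideals, against
   [share]. *)
have nl : ~ big leveled.
  move=> h; have [p pP] : exists p : lam -> set lam, forall z, leveled z ->
      [/\ level_set (p z), p z `<=` a z & ~ J z (p z)].
    exists (fun z => if pselect (leveled z) is left l then projT1 (cid l) else set0) => z lz.
    by case: pselect => // l; exact: (projT2 (cid l)).
  have [m /big_two[z [x [[/pP[lz za nz] ez] [/pP[lx xa nx] ex] n]]]] :=
    pigeonhole (fun z => E (p z)) (le_mu_th (inj_le_refl mu)) h.
  have e : p z = p x by apply: Ei => //; rewrite ez ex.
  by apply: nx; rewrite -e; apply: share nz => //; rewrite e.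
have drop Y (b : lam -> Prop) : big Y -> ~ big (fun z => Y z /\ b z) -> big (fun z => Y z /\ ~ b z).
  move=> bY n; have [[] h] := pigeonhole (fun z => `[< b z >]) (le_mu_th bool_le) bY.
    by case: n; apply: inj_le_trans h _; apply: sub_mono => z [Yz /asboolP].
  by apply: inj_le_trans h _; apply: sub_mono => z [Yz /asboolP].
have Y0 : big (fun z => setT z /\ ~ leveled z).
  apply: drop; first exact: le_sub_setT.
  by move=> h; apply: nl; apply: inj_le_trans h _; apply: sub_mono => z [].
have [p pP] : exists p : lam -> bool * set lam * ka * lam * lseq, forall z, ~ leveled z ->
    piece (a z) (J z) (p z).
  have [d0 _] := ka_pt; have [f _] := lam_inf.
  apply: (ex_choice (P := fun z p => ~ leveled z -> piece (a z) (J z) p)) => z.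
  have [l|n] := pselect (leveled z).
    by exists (true, set0, d0, f 0, [::]) => /(_ l).
  by have [l|[p pz]] := piece_ex (J_ideal z) (a_algebra z) (@J_not z); [case: (n l)|exists p].
pose al z : lam := (p z).1.2; pose t z : lseq := (p z).2.
have [[[k m] d1] big1] := pigeonhole (N := bool * mu * ka) (fun z => ((p z).1.1.1.1, E (p z).1.1.1.2, (p z).1.1.2))
  (le_mu_th (inj_le_prod mu_inf (inj_le_prod mu_inf bool_le (inj_le_refl mu)) ka_mu)) Y0.
have [v big1'] := pigeonhole (fun z => nod d1 (al z)) (le_mu_th (inj_le_refl mu)) big1.
pose Y z := [/\ ~ leveled z, (p z).1.1.1.1 = k, E (p z).1.1.1.2 = m, (p z).1.1.2 = d1 & nod d1 (al z) = v].
have bY : big Y by apply: inj_le_trans big1' _; apply: sub_mono => z [[[_ nz] [e1 e2 e3]] e4].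
have [q qP] : exists q, forall z, Y z -> (p z).1.1.1.2 = q.
  have [z [_ [Yz _ _]]] := big_two bY; exists (p z).1.1.1.2 => x Yx.
  have [nx _ ex _ _] := Yx; have [nz _ ez _ _] := Yz.
  have := pP x nx; have := pP z nz; rewrite /piece; case: (p z) ez => [[[[k1 q1] ?] ?] ?] /= ez [lz _ _ _ _].
  by case: (p x) ex => [[[[k2 q2] ?] ?] ?] /= ex [lx _ _ _ _]; apply: Ei => //; rewrite ex ez.
have YP z : Y z -> piece (a z) (J z) (k, q, d1, al z, t z).
  move=> Yz; have [nz e1 _ e3 _] := Yz; have := pP z nz; have := qP z Yz.
  by rewrite /al /t; case: (p z) e1 e3 => [[[[k1 q1] d2] a2] t2] /= -> -> ->.
(* With the sign and [q] fixed, equal sequences [t] give a shared piece. Hence a small class of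
   indices carries few members. *)
have t_inj z x : Y z -> Y x -> t z = t x -> z = x.
  move=> Yz Yx e; apply: contrapT => n.
  have [_ _ _ _ [zs zn]] := YP z Yz; have [_ _ _ _ [xs xn]] := YP x Yx.
  by apply: xn; rewrite -e; apply: share zn => //; rewrite e.
have class_thin u : ~ big (fun z => Y z /\ forall d, nod d (al z) = nd d u).
  pose cl := sub (fun b => forall d, nod d b = nd d u).
  have ncl : ~ (lam <~ seq cl).
    case: (inj_le_total cl mu) => h h'.
      by apply: lam_mu; apply: inj_le_trans h' _; apply: seq_le.
    apply: (@class_small u); apply: inj_le_trans h' _; apply: seq_le; last exact: inj_le_refl.
    exact: inj_le_trans mu_inf h.
  move=> h; apply: ncl; apply: inj_le_trans h _.
  apply: (@rel_inj _ _ (fun z (l : seq cl) => map sval l = t (sval z))) => [[z [Yz zu]]|z z' l e e'] /=.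
    have [_ _ [_ tz] _ _] := YP z Yz.
    have : forall c, c \in t z -> forall d, nod d c = nd d u by move=> c ct d; rewrite (tz c ct).
    elim: (t z) => [|c s IH] h'; first by exists [::].
    have [l lP] := IH (fun c cs => h' c (mem_behead (s := _ :: _) cs)).
    by exists (exist _ (c : lam) (h' c (mem_head _ _)) :: l) => /=; rewrite lP.
  apply: sub_eq; have [Yz _] := svalP z; have [Yz' _] := svalP z'.
  by apply: t_inj => //; rewrite -e.
have /choice[W WP] d : exists W : lam -> mu, forall b b', W b = W b' -> agree d b b'.
  have [b [_ bP]] := bounded d.
  have [g gi] : set (sub (Ps d)) <~ mu.
    apply/not_inj_le/mu_lim => h; apply: (@seg_initial mu b); apply: inj_le_trans h _; exact: sub_mono.
  exists (fun c => g (fun y => D c (sval y))) => c c' /gi e y dy.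
  by have := congr1 (fun f => f (exist _ y dy)) e => /= ->.
(* Every cell of a member [z] that is not bad is large, so [R_big] can be applied inside cells. *)
pose cell d z : set lam := fun x => [/\ Y x, nod d (al x) = nod d (al z) & W d (al x) = W d (al z)].
pose bad z := exists d, ~ big (cell d z).
(* Otherwise one of at most [mu] cells, each chosen small, would contain [lam] bad members. *)
have big2 : big (fun z => Y z /\ ~ bad z).
  apply: drop bY _ => h.
  have [d dP] : exists d : lam -> ka, forall z, bad z -> ~ big (cell (d z) z).
    have [d0 _] := ka_pt; apply: (ex_choice (P := fun z d => bad z -> ~ big (cell d z))) => z; have [[d dz]|n] := pselect (bad z); first by exists d.
    by exists d0.
  have [c h'] := pigeonhole (fun z => (d z, nod (d z) (al z), W (d z) (al z)))
    (le_mu_th (inj_le_prod mu_inf (inj_le_prod mu_inf ka_mu (inj_le_refl mu)) (inj_le_refl mu))) h.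
  have [z [_ [[[Yz bz] ez] _ _]]] := big_two h'.
  apply: (dP z bz); apply: inj_le_trans h' _; apply: sub_mono => x [[Yx bx]].
  by rewrite -ez => -[-> e1 e2]; split.
pose Q u := exists z, (Y z /\ ~ bad z) /\ i (al z) = u.
(* If fewer than [th] values of [i] occurred, one class would carry [lam] members, against
   [class_thin]. *)
have thQ : th <~ sub Q.
  apply: contrapT => nQ.
  have [z0 [_ [Yz0 _ _]]] := big_two big2.
  have Q0 : Q (i (al z0)) by exists z0.
  have [[u Qu] h] := pigeonhole (fun z => if pselect (Q (i (al z))) is left h then exist Q _ h else exist Q _ Q0)
    nQ big2.
  apply: (@class_thin u); apply: inj_le_trans h _; apply: sub_mono => z [[Yz bz]].
  case: pselect => [h' [e]|[]]; last by exists z.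
  by split=> // d; rewrite -e.
have [s sP] : exists s : th -> lam, forall u, Q u -> (Y (s u) /\ ~ bad (s u)) /\ i (al (s u)) = u.
  apply: (ex_choice (P := fun u z => Q u -> (Y z /\ ~ bad z) /\ i (al z) = u)) => u; have [[z zP]|n] := pselect (Q u); first by exists z.
  by have [f _] := lam_inf; exists (f 0).
have [d [u1 [u2 [/sP[[Y1 n1] e1] /sP[[Y2 n2] e2] nn ag]]]] := split_nd (fun u => D (al (s u))) thQ.
have {}nn : nod d (al (s u1)) <> nod d (al (s u2)) by rewrite /nod e1 e2.
have {}ag : agree d (al (s u1)) (al (s u2)) by [].
(* The split is moved to members [z'], [x'] of the same cells with [R z' x']. The part of the piece
   of [z'] that follows its branch up to [d] lies in [a x'], thus in the ideal; the rest is a level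
   set, also in the ideal because [z'] is not leveled. *)
have cross z x : Y z -> Y x -> ~ bad z -> ~ bad x -> nod d (al z) <> nod d (al x) ->
    agree d (al z) (al x) -> (forall d0, split_at d0 (al z) (al x) -> oriented k d0 (al z) (al x)) -> False.
  move=> Yz Yx bz bx nzx agzx o.
  have bigz : big (cell d z) by apply: contrapT => h; apply: bz; exists d.
  have bigx : big (cell d x) by apply: contrapT => h; apply: bx; exists d.
  have [z' [x' [[Yz' ez wz] [Yx' ex wx] Rzx]]] := R_big bigz bigx.
  have n' : nod d (al z') <> nod d (al x') by rewrite ez ex.
  have ag' : agree d (al z') (al x').
    exact: (agree_trans (WP d _ _ wz) (agree_trans agzx (agree_sym (WP d _ _ wx)))).
  have [d0 d0d s0] := split_atP n'.
  have o' : oriented k d0 (al z') (al x').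
    have s0' : split_at d0 (al z) (al x).
      case: s0 => h1 h2; split=> [d' h|h]; last by apply: h2; rewrite (nod_le d0d ez) (nod_le d0d ex).
      have l : cle d' d by apply: cle_trans (cltW h) d0d.
      by rewrite -(nod_le l ez) -(nod_le l ex) h1.
    by have := o d0 s0'; rewrite /oriented (nod_le d0d ez) (nod_le d0d ex).
  have [lq qn [at_ tz] _ [qz nJ]] := YP z' Yz'.
  have [_ _ [_ tx] tk [qx _]] := YP x' Yx'.
  have [_ _ JU] := J_ideal z'.
  apply: nJ; pose K b := nod d b = nod d (al z').
  apply: (J_sub (B := (q `&` vee k (t z') `&` K) `|` (q `&` vee k (t z') `&` ~` K))).
    by move=> b h; have [Kb|Kb] := pselect (K b); [left|right].
  apply: JU.
    apply: J_sub (J_mem Rzx) => b [[qb vb] Kb]; apply: qx; split=> //.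
    exact: (vee_cross at_ tx tk ag' d0d s0 o' Kb vb).
  have [nz' _ _ _ _] := Yz'.
  apply: contrapT => h; apply: nz'; exists (q `&` vee k (t z') `&` ~` K); split=> //; last by move=> b [/qz].
  have [dq [yq supq]] := lq; have [yd [_ ydP]] := bounded d.
  exists (cmax dq d), (cmax yq yd) => b b' e ab _ [[qb vb] Kb].
  have eb : nod d b = nod d b' by apply: nod_le e; exact: cmaxr.
  split; last by rewrite /K /= -eb.
  split.
    apply: (supq b) => //; [by apply: nod_le e; exact: cmaxl|by apply: below_agree_le ab; exact: cmaxl].
  apply: (vee_level tz Kb eb) => // y /ydP yy; apply: ab; exact: clt_le_trans yy (cmaxr _ _).
have [d0 d0d s0] := split_atP nn.
have uo z x : split_at d0 z x -> oriented k d0 z x -> forall d', split_at d' z x -> oriented k d' z x.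
  by move=> sz o d' sz'; rewrite -(split_at_unique sz sz').
have sC z x : split_at d0 z x -> split_at d0 x z.
  by move=> [h1 h2]; split=> [d' /h1|] //; exact: nesym.
have [o|o] : oriented k d0 (al (s u1)) (al (s u2)) \/ oriented k d0 (al (s u2)) (al (s u1)).
  rewrite /oriented; case: (clt_or (nod d0 (al (s u1))) (nod d0 (al (s u2)))) => h.
  - by case: s0.
  - by case: (k); [right|left].
  - by case: (k); [left|right].
- exact: (cross _ _ Y1 Y2 n1 n2 nn ag (uo _ _ s0 o)).
- exact: (cross _ _ Y2 Y1 n2 n1 (nesym nn) (agree_sym ag) (uo _ _ (sC _ _ s0) o)).
Qed.

End NoFree.

Definition tree_field : set_field lam.
Proof.
apply: (@SetField _ algebra) => [|A B|A]; [|exact: algebraI|exact: algebraC].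
by apply: level_set_algebra; have [d _] := ka_pt; have [y _] := mu_pt; exists d, y => b b' _ _ _ [].
Defined.

Lemma tree_field_ex : exists F : set_field lam,
  [/\ lam <~ sub (field_sets F), sub (field_sets F) <~ lam,
      forall eta, ~ (lam <~ eta) -> exists (X : set lam) (g : lam -> set lam),
        [/\ ~ (sub X <~ eta), forall a, field_sets F (g a) &
            forall a b, X a -> X b -> (g a b <-> b = a)] &
      forall (R : lam -> lam -> Prop) (J : lam -> set (set lam)) (a : lam -> set lam),
        (forall z x, z <> x -> R z x \/ R x z) ->
        (forall Y1 Y2, big Y1 -> big Y2 -> exists z x, [/\ Y1 z, Y2 x & R z x]) ->
        (forall z, ideal_of_sets (J z)) -> (forall z, field_sets F (a z)) ->
        (forall z x, R z x -> J z (a x)) -> ~ forall z, ~ J z (a z)].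
Proof.
exists tree_field; split; [exact: le_algebra|exact: algebra_le|move=> eta /class_large[t tP]|].
  exists (fun b => forall d, nod d b = nd d t), gen; split=> // [a|a b ha hb]; first exact: algebra_gen.
  by split=> [|->]; [apply: gen_equiv => d; rewrite ha hb|left].
by move=> R J a h1 h2 h3 h4 h5; exact: (no_free h1 h2 h3 h4 h5).
Qed.

End TreeAlgebra.

(** * Invariants of the algebra *)

Section Ideals.
Context {d : Order.disp_t} {B : ctbDistrLatticeType d}.
Implicit Types X : set B.

Lemma ideal_gen_ideal X : is_ideal (ideal_gen X).
Proof.
split=> [I [[h _ _]]//|x y xy hy I [iI XI]|x y hx hy I [iI XI]]; have [_ h2 h3] := iI.
  by apply: h2 xy _; exact: hy.
by apply: h3; [exact: hx|exact: hy].
Qed.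

Lemma sub_ideal_gen X : X `<=` ideal_gen X.
Proof. by move=> x Xx I [_]; exact. Qed.

Lemma ideal_gen_sub X I : is_ideal I -> X `<=` I -> ideal_gen X `<=` I.
Proof. by move=> iI XI x; apply. Qed.

End Ideals.

Section FieldSequences.
Variables (d : Order.disp_t) (B : ctbDistrLatticeType d) (lam : cardinal).
Variables (F : set_field lam) (v : B -> set lam).
Hypothesis lam_inf : nat <~ lam.
Hypothesis v_range : forall A, field_sets F A <-> exists b, v b = A.
Hypothesis v_le : forall a b, (a <= b)%O <-> v a `<=` v b.
Hypothesis v_join : forall a b, v (Order.join a b) = v a `|` v b.
Hypothesis v0 : v Order.bottom = set0.
Hypothesis F_large : forall eta, ~ (lam <~ eta) -> exists (X : set lam) (g : lam -> set lam),
  [/\ ~ (sub X <~ eta), forall a, field_sets F (g a) &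
      forall a b, X a -> X b -> (g a b <-> b = a)].
Hypothesis F_no_free : forall (R : lam -> lam -> Prop) (J : lam -> set (set lam)) (a : lam -> set lam),
  (forall z x, z <> x -> R z x \/ R x z) ->
  (forall Y1 Y2, big Y1 -> big Y2 -> exists z x, [/\ Y1 z, Y2 x & R z x]) ->
  (forall z, ideal_of_sets (J z)) -> (forall z, field_sets F (a z)) ->
  (forall z x, R z x -> J z (a x)) -> ~ forall z, ~ J z (a z).

(** The sets covered by an element of the generated ideal form an ideal of arbitrary subsets of
    [lam], to which [F_no_free] applies. *)
Lemma not_ideal_free (R : lam -> lam -> Prop) (a : lam -> B) :
  (forall z x, z <> x -> R z x \/ R x z) ->
  (forall Y1 Y2, big Y1 -> big Y2 -> exists z x, [/\ Y1 z, Y2 x & R z x]) -> ~ ideal_free R a.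
Proof.
move=> h1 h2 free.
pose Id z := ideal_gen (a @` [set x | R z x]).
pose J z (A : set lam) := exists2 b, Id z b & A `<=` v b.
apply: (F_no_free (R := R) (J := J) (a := fun z => v (a z)) h1 h2) => [z|z|z x Rzx|z [b Ib ab]].
- have [i0 _ i3] := ideal_gen_ideal (a @` [set x | R z x]).
  split=> [|A C AC [b Ib Cb]|A C [b Ib Ab] [c Ic Cc]]; first by exists Order.bottom.
    by exists b => // x /AC/Cb.
  exists (Order.join b c); first exact: i3.
  by rewrite v_join => x [/Ab|/Cc]; [left|right].
- by apply/v_range; exists (a z).
- by exists (a x) => //; apply: sub_ideal_gen; exists x.
- have [_] := free z; apply; have [_ i2 _] := ideal_gen_ideal (a @` [set x | R z x]).
  by apply: i2 Ib; exact/v_le.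
Qed.

(** The elements whose set omits the point [f t] form an ideal that contains all the other chosen
    elements but not the one at [f t]. *)
Lemma ideal_free_ex (T : Type) (R : T -> T -> Prop) (X : set lam) (g : lam -> set lam) :
  (forall a, field_sets F (g a)) -> (forall a b, X a -> X b -> (g a b <-> b = a)) ->
  T <~ sub X -> (forall t u, R t u -> u <> t) -> exists a : T -> B, ideal_free R a.
Proof.
move=> Fg gX [f fi] R_irr.
have [a aP] : exists a : lam -> B, forall x, v (a x) = g x.
  by apply: (ex_choice (P := fun x b => v b = g x)) => x; exact/v_range.
exists (fun t => a (sval (f t))) => t; pose x := sval (f t).
have Xx : X x := svalP (f t).
have gx : v (a x) x by rewrite aP; apply/(gX x x).
split=> [e|h]; first by move: gx; rewrite /x e v0.
suff : [set b | ~ v b x] (a x) by apply.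
move: h; apply: ideal_gen_sub.
  split=> /= [|b c /v_le bc nc /bc//|b c nb nc]; first by rewrite v0.
  by rewrite v_join => -[].
move=> _ [u Rtu <-] /=; rewrite aP => /(gX _ _ (svalP (f u)) Xx)/sub_eq/fi e.
by apply: (R_irr _ _ Rtu); rewrite e.
Qed.

Lemma ideal_free_lt (theta : cardinal) (R : theta -> theta -> Prop) : ~ (lam <~ theta) ->
  (forall t u, R t u -> u <> t) -> exists a : theta -> B, ideal_free R a.
Proof.
by move=> /F_large[X [g [n Fg gX]]]; apply: ideal_free_ex Fg gX _; exact: not_inj_le.
Qed.

Lemma ideal_free_inj (T : Type) (a : T -> B) : ideal_free (fun t u => u <> t) a -> injective a.
Proof.
move=> free t u e; apply: contrapT => n; have [_] := free t; apply.
by apply: sub_ideal_gen; exists u => // /esym.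
Qed.

Lemma big_unbounded (Y : set lam) x : big Y -> exists2 y, Y y & clt x y.
Proof.
move=> bY; apply: contrapT => H; apply: (sub_closed_lt (m := x) lam_inf).
apply: inj_le_trans bY _; apply: sub_mono => y Yy; apply/cleNgt => h; apply: H; by exists y.
Qed.

Let big_pt (Y : set lam) : big Y -> exists y, Y y.
Proof. by move=> [e _]; have [f _] := lam_inf; exists (sval (e (f 0))); exact: (svalP (e _)). Qed.

Let clt_sym_or (z x : lam) : z <> x -> clt z x \/ clt x z.
Proof. by case: (clt_or z x); [|left|right]. Qed.

Lemma no_s_seq : ~ has_s_seq B lam.
Proof.
move=> [a]; apply: not_ideal_free => [z x n|Y1 Y2 b1 b2]; first by left=> e; apply: n.
have [z Yz] := big_pt b1; have [x Yx zx] := big_unbounded z b2.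
by exists z, x; split=> // e; apply: (clt_neq zx).
Qed.

Lemma no_hd_seq : ~ has_hd_seq B lam.
Proof.
move=> [a]; apply: not_ideal_free => [z x /nesym|Y1 Y2 b1 b2]; first exact: clt_sym_or.
have [x Yx] := big_pt b2; have [z Yz xz] := big_unbounded x b1.
by exists z, x.
Qed.

Lemma no_hL_seq : ~ has_hL_seq B lam.
Proof.
move=> [a]; apply: not_ideal_free => [z x|Y1 Y2 b1 b2]; first exact: clt_sym_or.
have [z Yz] := big_pt b1; have [x Yx zx] := big_unbounded z b2.
by exists z, x.
Qed.

Lemma is_s_field : B <~ lam -> is_s B lam.
Proof.
move=> Bl; split=> [theta [a /ideal_free_inj ai]|eta etaP].
  by apply/inj_leP; apply: inj_le_trans Bl; exists a.
apply/inj_leP; apply: contrapT => /F_large[X [g [n Fg gX]]].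
have [k [h1 h2]] := card_of (sub X); apply: n; apply: inj_le_trans h1 _.
by apply/inj_leP/etaP; exact: (ideal_free_ex Fg gX h2).
Qed.

Lemma is_s_plus_field : is_s_plus B lam.
Proof.
split=> [|theta n]; first exact: no_s_seq.
by apply/inj_leP; apply: contrapT => /ideal_free_lt h; apply: n; exact: h.
Qed.

Lemma is_hd_plus_field : is_hd_plus B lam.
Proof.
split=> [|theta n]; first exact: no_hd_seq.
by apply/inj_leP; apply: contrapT => /ideal_free_lt h; apply: n; apply: h => t u; exact: clt_neq.
Qed.

Lemma is_hL_plus_field : is_hL_plus B lam.
Proof.
split=> [|theta n]; first exact: no_hL_seq.
by apply/inj_leP; apply: contrapT => /ideal_free_lt h; apply: n; apply: h => t u /clt_neq/nesym.
Qed.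

End FieldSequences.

Lemma strong_limit_set (mu : cardinal) : strong_limit mu ->
  forall T, ~ (mu <~ T) -> ~ (mu <~ set T).
Proof.
move=> [_ lim] T n; have [k [h1 h2]] := card_of T.
have [|_ H] := lim k.
  split; first by apply/inj_leP; exact: inj_le_trans h2 (not_inj_le n).
  by move=> /inj_leP h; apply: n; exact: inj_le_trans h h2.
by move=> h; apply: H; apply/inj_leP; apply: inj_le_trans h _; exact: set_mono.
Qed.

Theorem theorem5p1 (mu lam cf_mu cf_lam : cardinal)
    (mu_strong_limit : strong_limit mu) (mu_singular : singular mu)
    (cf_muP : is_cf mu cf_mu) (cf_lamP : is_cf lam cf_lam)
    (aleph0_lt_cf_mu : type_card_lt nat cf_mu) (cf_mu_lt_mu : type_card_lt cf_mu mu)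
    (mu_lt_cf_lam : type_card_lt mu cf_lam) (cf_lam_lt_lam : type_card_lt cf_lam lam)
    (lam_le_pow_mu : type_card_le lam (set mu)) :
  exists (d : Order.disp_t) (B : ctbDistrLatticeType d),
    [/\ type_card_eq B lam, is_s B lam, is_s_plus B lam,
        is_hd_plus B lam & is_hL_plus B lam].
Proof.
have mu_inf : nat <~ mu by apply/inj_leP; case: mu_strong_limit.
have mu_lim := strong_limit_set mu_strong_limit.
have [[z zP] ka_min] := is_cfP cf_muP.
have [lam_cof lam_min] := is_cfP cf_lamP.
have [/inj_leP ka_inf ka_unc] := aleph0_lt_cf_mu; rewrite inj_leP in ka_unc.
have [/inj_leP ka_le mu_ka] := cf_mu_lt_mu; rewrite inj_leP in mu_ka.
have [/inj_leP mu_th th_mu] := mu_lt_cf_lam; rewrite inj_leP in th_mu.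
have [/inj_leP th_le th_lam] := cf_lam_lt_lam; rewrite inj_leP in th_lam.
move/inj_leP: lam_le_pow_mu => lam_pow.
have th_inf := inj_le_trans mu_inf mu_th.
have lam_inf := inj_le_trans th_inf th_le.
have ka_reg := cofin_regular ka_inf zP ka_min.
have [w wP] := lam_cof; have th_reg := cofin_regular th_inf wP lam_min.
have ka_cof : exists w : cf_mu -> mu, forall x, exists d, cle x (w d).
  by exists z => x; exact: (proj2 zP).
have ka_bound N (h : N -> mu) : ~ (cf_mu <~ N) -> exists b, forall n, clt (h n) b.
  move=> nN; have [b [_ bP]] := cofin_bound (X := setT) ka_min nN (fun n => Logic.I : setT (h n)).
  by exists b; exact: bP.
have [nd [Ps [T1 T2 T3 T4 T5]]] := branching_tree mu_inf mu_lim ka_reg ka_unc mu_ka ka_cof ka_bound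
  th_reg th_mu (inj_le_trans th_le lam_pow).
have [D D_inj] := lam_pow; have [i iP] := cof_index lam_inf lam_cof.
have ka_pt : exists d : cf_mu, True by have [f _] := ka_inf; exists (f 0).
have [F [F1 F2 F3 F4]] := tree_field_ex mu_inf mu_lim ka_le ka_pt th_mu th_lam lam_min
  D_inj iP T1 T2 T3 T4 T5.
have [d [B [v [v_inj v_range v_le v_join v0]]]] := field_representation F.
have BF : B <~ sub (field_sets F).
  by apply: (inj_sub v_inj) => b; apply/v_range; exists b.
have FB : sub (field_sets F) <~ B.
  apply: (@surj_inj _ _ (fun b => exist _ (v b) (proj2 (v_range (v b)) (ex_intro _ b erefl)))).
  move=> [A FA]; have [b bA] := proj1 (v_range A) FA; exists b; exact: sub_eq.
exists d, B; split.
- apply/card_eq_sub; split.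
    exact: inj_le_trans (sub_setT _) (inj_le_trans BF (inj_le_trans F2 (le_sub_setT _))).
  exact: inj_le_trans (sub_setT _) (inj_le_trans F1 (inj_le_trans FB (le_sub_setT _))).
- exact: (is_s_field v_range v_le v_join v0 F3 (inj_le_trans BF F2)).
- exact: (is_s_plus_field lam_inf v_range v_le v_join v0 F3 F4).
- exact: (is_hd_plus_field lam_inf v_range v_le v_join v0 F3 F4).
- exact: (is_hL_plus_field lam_inf v_range v_le v_join v0 F3 F4).
Qed.
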